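(* Let $M\ge1$, let $Q$ be the known pre-change distribution with pdf $q$ with respect to $\mu$, let $\mathcal P=\bigcup_{m=1}^M\mathcal P^{(m)}_{n_m}$ be the union of the $M$ Wasserstein uncertainty sets with $Q\notin\mathcal P$, let $P^*_{(m)}$ be the least favorable distribution of the $m$-th set, and write $$I^*:=\min_{m=1,\ldots,M}\mathsf{KL}(P^*_{(m)}\|Q).$$ Then the DR-CuSum test $\tau_{\mathrm{DR}}(b_\gamma)$ with threshold $b_\gamma=\log(M\gamma)$ solves the problem $$\inf_{\tau\in C(\gamma)}\ \sup_{P\in\mathcal P}\mathsf{WADD}^P(\tau)$$ asymptotically as $\gamma\to\infty$; that is, $\tau_{\mathrm{DR}}(b_\gamma)\in C(\gamma)$ and, as $\gamma\to\infty$, $$\sup_{P\in\mathcal P}\mathsf{WADD}^P(\tau_{\mathrm{DR}}(b_\gamma))=\inf_{\tau'\in C(\gamma)}\ \sup_{P\in\mathcal P}\mathsf{WADD}^P(\tau')\cdot(1+o(1))=\frac{\log\gamma}{I^*}\cdot(1+o(1)).$$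
   Context: Change-point model: $X_1,X_2,\ldots$ are independent random vectors with values in $\mathscr X$, observed sequentially, $\mathcal F_k=\sigma(X_1,\ldots,X_k)$, $\mathcal F_0$ trivial. At an unknown deterministic time $\nu$ the distribution changes from $Q$ to $P$: $X_k\sim Q$ for $k<\nu$ and $X_k\sim P$ for $k\ge\nu$. $\mathbb E^P_\nu$ is the expectation when the change-point is $\nu$ and the pre-/post-change distributions are $Q$ and $P$; $\mathbb E_\infty$ is the expectation when there is no change (all $X_k\sim Q$). Tests are stopping times $\tau$ with respect to $(\mathcal F_k)$. $C(\gamma)=\{\tau:\mathbb E_\infty[\tau]\ge\gamma\}$, and $$\mathsf{WADD}^P(\tau)=\sup_{\nu\ge1}\operatorname{ess\,sup}\ \mathbb E^P_\nu[(\tau-\nu+1)^+\mid\mathcal F_{\nu-1}].$$ Uncertainty sets: $\mu$ is the Lebesgue measure, $s\ge1$, $c(\cdot,\cdot)$ is a metric on $\mathscr X$, $\mathscr P_s$ is the set of Borel probability measures $P$ on $\mathscr X$ with $\int c^s(x,x_0)dP(x)<\infty$ for all $x_0\in\mathscr X$, and $\mathsf W_s(P,\tilde P)=\{\min_{\Gamma\in\Pi(P,\tilde P)}\int c^s(\omega,\tilde\omega)d\Gamma(\omega,\tilde\omega)\}^{1/s}$, with $\Pi(P,\tilde P)$ the set of couplings of $P$ and $\tilde P$. For $m=1,\ldots,M$, $\omega^{(m)}_1,\ldots,\omega^{(m)}_{n_m}\in\mathscr X$ are given training samples with empirical distribution $\widehat P^{(m)}_{n_m}=\frac1{n_m}\sum_j\delta_{\omega_j^{(m)}}$,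 $r_{s,m}\ge0$ is a radius, and $\mathcal P^{(m)}_{n_m}=\{P\in\mathscr P_s:\mathsf W_s(P,\widehat P^{(m)}_{n_m})\le r_{s,m}\}$. Least favorable distributions: $P^*_{(m)}$ is the minimizer of $\mathsf{KL}(P\|Q)$ over $P\in\mathcal P^{(m)}_{n_m}$, where $\mathsf{KL}(P\|Q)=\int\log(dP/dQ)\,dP$ ($=\infty$ if $P\not\ll Q$); $p^*_{(m)}$ denotes its pdf with respect to $\mu$. Its log-likelihood ratio is $$\log\frac{p^*_{(m)}(x)}{q(x)}=-C^{(m)}_{\lambda_m^*,u_m^*}(x)-\log\eta^{(m)}(\lambda_m^*,u_m^* ),$$ where $C^{(m)}_{\lambda,u}(x)=\min_{1\le j\le n_m}\{\lambda c^s(x,\omega^{(m)}_j)-u_j\}$, $\eta^{(m)}(\lambda,u)=\int q(x)\exp\{-C^{(m)}_{\lambda,u}(x)\}d\mu(x)$, and $(\lambda_m^*,u_m^* )$ maximizes $-\lambda r_{s,m}^s+\frac1{n_m}\sum_{j=1}^{n_m}u_j-\log\eta^{(m)}(\lambda,u)$ over $\lambda\ge0$, $u\in\mathbb R^{n_m}$. DR-CuSum test: for each $m$, $S^{(m)}_0=0$ and $S^{(m)}_k=(S^{(m)}_{k-1})^++\log\frac{p^*_{(m)}(X_k)}{q(X_k)}$ for $k\ge1$; $\tau_{\mathrm{DR}}(b)=\inf\{k\in\mathbb N:\max_{m=1,\ldots,M}S^{(m)}_k\ge b\}$. The training samples, hence the sets $\mathcal P^{(m)}_{n_m}$, are fixed;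 $o(1)\to0$ as $\gamma\to\infty$. *)

(* Defs.v *)
From HB Require Import structures.
From mathcomp Require Import all_boot all_order all_algebra finmap.
From mathcomp Require Import all_classical all_reals all_analysis.
From mathcomp Require Import measurable_realfun ess_sup_inf.
From mathcomp Require Import lra.

Set Implicit Arguments.
Unset Strict Implicit.
Unset Printing Implicit Defensive.

Import Order.TTheory GRing.Theory Num.Theory.
Import numFieldNormedType.Exports.

Local Open Scope classical_set_scope.
Local Open Scope ring_scope.
Local Open Scope charge_scope.
Local Open Scope ereal_scope.

(** * Lebesgue measure on R^d *)

(** R^d is [d.-tuple R] with the product sigma-algebra of the Borel sets of R,
    that is, the Borel sets of R^d.  Lebesgue measure is the d-fold product of
    [lebesgue_measure], transported from [R * d.-tuple R] to [d.+1.-tuple R];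
    [lebesgue_tuple_box] gives its value on boxes. *)
Section lebesgue_tuple.
Context {R : realType}.

Definition tuple_cons (d : nat) (z : measurableTypeR R * d.-tuple R) :
  d.+1.-tuple R := [tuple of z.1 :: z.2].

Lemma measurable_tuple_cons d : measurable_fun setT (@tuple_cons d).
Proof.
apply: (measurable_cons (f := (fun z : measurableTypeR R * d.-tuple R =>
  (z.1 : R)))); first exact: measurable_fst.
exact: measurable_snd.
Qed.

Section step.
Variables (d : nat) (m : {sigma_finite_measure set (d.-tuple R) -> \bar R}).

Definition lebesgue_step : set (d.+1.-tuple R) -> \bar R :=
  pushforward (@lebesgue_measure R \x m) (@tuple_cons d).

Let mcons A : measurable A -> measurable (@tuple_cons d @^-1` A).
Proof.
by move=> mA; rewrite -[X in measurable X]setTI; exact: measurable_tuple_cons.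
Qed.

Let step0 : lebesgue_step set0 = 0.
Proof. by rewrite /lebesgue_step /pushforward preimage_set0 measure0. Qed.

Let step_ge0 A : 0 <= lebesgue_step A.
Proof. exact: (measure_ge0 (@lebesgue_measure R \x m)). Qed.

Let step_sigma_additive : semi_sigma_additive lebesgue_step.
Proof.
move=> F mF tF mUF; rewrite /lebesgue_step /pushforward preimage_bigcup.
apply: measure_semi_sigma_additive.
- by move=> n; exact: mcons.
- apply/trivIsetP => /= i j _ _ ij; rewrite -preimage_setI.
  by move/trivIsetP : tF => /(_ _ _ _ _ ij) ->//; rewrite preimage_set0.
- by rewrite -preimage_bigcup; exact: mcons.
Qed.

HB.instance Definition _ := isMeasure.Build _ _ _ lebesgue_step
  step0 step_ge0 step_sigma_additive.

Let step_sigma_finite : sigma_finite setT lebesgue_step.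
Proof.
have /sigma_finiteP[F [FT ndF Foo]] := sigma_finiteT (@lebesgue_measure R).
have /sigma_finiteP[G [GT ndG Goo]] := sigma_finiteT m.
pose un (t : d.+1.-tuple R) : measurableTypeR R * d.-tuple R :=
  (thead t, [tuple of behead t]).
have unK : cancel un (@tuple_cons d).
  by move=> t; rewrite /tuple_cons /= -tuple_eta.
have consK : cancel (@tuple_cons d) un.
  by case=> x t; congr pair; apply/val_inj.
have mun : measurable_fun setT un.
  apply/measurable_fun_pairP; split; first exact: measurable_tnth.
  exact: measurable_behead.
exists (fun k => un @^-1` (F k `*` G k)).
  apply/seteqP; split=> // t _.
  have [i _ Fi] : (\bigcup_k F k) (un t).1 by rewrite -FT.
  have [j _ Gj] : (\bigcup_k G k) (un t).2 by rewrite -GT.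
  exists (maxn i j) => //; split.
  - by move: Fi; exact/subsetPset/ndF/leq_maxl.
  - by move: Gj; exact/subsetPset/ndG/leq_maxr.
move=> k; have [mFk Fk] := Foo k; have [mGk Gk] := Goo k; split.
  by rewrite -[X in measurable X]setTI; apply: mun => //; exact: measurableX.
rewrite /lebesgue_step /pushforward -comp_preimage.
rewrite (_ : un \o _ = id) ?preimage_id; last by apply/funext => z; exact: consK.
by rewrite product_measure1E// lte_mul_pinfty// ge0_fin_numE.
Qed.

HB.instance Definition _ := Measure_isSigmaFinite.Build _ _ _ lebesgue_step
  step_sigma_finite.

End step.

Fixpoint lebesgue_tuple (d : nat) :
    {sigma_finite_measure set (d.-tuple R) -> \bar R} :=
  if d is d'.+1 then lebesgue_step (lebesgue_tuple d') else \d_[tuple].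

Lemma lebesgue_tuple_box (d : nat) (I : d.-tuple (set (measurableTypeR R))) :
  (forall i, measurable (tnth I i)) ->
  lebesgue_tuple d [set t | forall i, tnth I i (tnth t i)] =
  \prod_(i < d) lebesgue_measure (tnth I i).
Proof.
elim: d I => [|d IH] I mI.
  rewrite big_ord0 /= /dirac indicE mem_set//.
  by case.
rewrite big_ord_recl /= /lebesgue_step /pushforward.
have mI' i : measurable (tnth [tuple of behead I] i).
  by rewrite tnth_behead; exact: mI.
have -> : @tuple_cons d @^-1` [set t | forall i, tnth I i (tnth t i)] =
    tnth I ord0 `*` [set t | forall i, tnth [tuple of behead I] i (tnth t i)].
  apply/seteqP; split=> -[x t] /=.
    move=> h; split; first by have := h ord0; rewrite tnth0.
    move=> i; have := h (lift ord0 i).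
    by rewrite tnthS tnth_behead (_ : inord i.+1 = lift ord0 i)//;
       apply/val_inj; rewrite /= inordK// ltnS.
  move=> [hx ht] i; case: (unliftP ord0 i) => [j|] ->; last by rewrite tnth0.
  rewrite tnthS; have := ht j.
  by rewrite tnth_behead (_ : inord j.+1 = lift ord0 j)//;
     apply/val_inj; rewrite /= inordK// ltnS.
rewrite product_measure1E//; last first.
  rewrite (_ : [set _ | _] = \bigcap_(i in setT)
     ((fun t : d.-tuple R => tnth t i) @^-1` tnth [tuple of behead I] i)).
    apply: fin_bigcap_measurable => // i _; rewrite -[X in measurable X]setTI.
    exact: (@measurable_tnth _ R d i measurableT _ (mI' i)).
  by apply/seteqP; split=> t /= h i => [_|]; exact: h.
rewrite IH//; congr (_ * _); apply: eq_bigr => i _.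
rewrite tnth_behead (_ : inord i.+1 = lift ord0 i)//.
by apply/val_inj; rewrite /= inordK// ltnS.
Qed.

End lebesgue_tuple.

(** * Relative entropy and Wasserstein uncertainty sets *)

Section uncertainty_sets.
Context {disp : measure_display} {T : measurableType disp} {R : realType}.
Implicit Types (P Q : probability T R) (D : set T) (c : T -> T -> R).

Definition KL P Q : \bar R :=
  if `[< P `<< Q >]
  then \int[P]_x lne ('d (charge_of_finite_measure P) '/d Q x)
  else +oo.

Definition has_pdf (mu : {measure set T -> \bar R}) D P (p : T -> R) : Prop :=
  [/\ measurable_fun D p, (forall x, D x -> (0 <= p x)%R) &
      forall A, measurable A -> P A = \int[mu]_(x in A `&` D) (p x)%:E].

(** The sample space is a Borel subset [D] of R^d.  A probability measure on
    [D] is a Borel probability measure [P] on R^d such that [P D = 1]; the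
    metric, the densities and the integrals are only looked at on [D]. *)
Definition is_metric_on D c : Prop :=
  [/\ (forall x y, D x -> D y -> (0 <= c x y)%R),
      (forall x y, D x -> D y -> (c x y = 0%R <-> x = y)),
      (forall x y, D x -> D y -> c x y = c y x) &
      forall x y z, D x -> D y -> D z -> (c x z <= c x y + c y z)%R].

Definition finite_moment D c (s : R) : set (probability T R) :=
  [set P | P D = 1 /\
    forall x0, D x0 -> \int[P]_(x in D) ((c x x0) `^ s)%:E < +oo].

Definition couplings P1 P2 : set (probability (T * T)%type R) :=
  [set G | forall A, measurable A ->
    G (A `*` setT) = P1 A /\ G (setT `*` A) = P2 A].

(** The infimum is attained, hence a minimum, in particular when [P2] has
    finite support, which is the only case used below. *)
Definition wasserstein D c (s : R) P1 P2 : \bar R :=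
  (ereal_inf [set \int[G]_(z in D `*` D) ((c z.1 z.2) `^ s)%:E
             | G in couplings P1 P2]) `^ (s^-1)%R.

Definition wasserstein_ball D c (s : R) P0 (r : R) : set (probability T R) :=
  [set P | finite_moment D c s P /\ wasserstein D c s P P0 <= r%:E].

(** Samples are indexed by ['I_n.+1], so that there is at least one of them. *)
Section empirical.
Variables (n : nat) (omega : 'I_n.+1 -> T).

Definition empirical (A : set T) : \bar R :=
  (n.+1%:R^-1)%R%:E * \sum_(j < n.+1) \d_(omega j) A.

Let weight_ge0 : (0 <= n.+1%:R^-1 :> R)%R.
Proof. by rewrite invr_ge0. Qed.

Let empiricalE : empirical = mscale (NngNum weight_ge0)
  (msum (fun j => \d_(omega (inord j)) : {measure set T -> \bar R}) n.+1).
Proof.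
apply/funext => A; rewrite /empirical /mscale/= /msum; congr (_ * _).
by apply: eq_bigr => j _; rewrite inord_val.
Qed.

Let empirical0 : empirical set0 = 0.
Proof. by rewrite empiricalE measure0. Qed.

Let empirical_ge0 A : 0 <= empirical A.
Proof. by rewrite empiricalE. Qed.

Let empirical_sigma_additive : semi_sigma_additive empirical.
Proof. by rewrite empiricalE; exact: measure_semi_sigma_additive. Qed.

HB.instance Definition _ := isMeasure.Build _ _ _ empirical
  empirical0 empirical_ge0 empirical_sigma_additive.

Let empirical_setT : empirical setT = 1.
Proof.
rewrite /empirical (eq_bigr (fun=> 1%:E)); last by move=> j _; rewrite diracT.
by rewrite sumEFin sumr_const card_ord -EFinM mulVf.
Qed.

HB.instance Definition _ := Measure_isProbability.Build _ _ _ empirical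
  empirical_setT.

End empirical.

(** The finite-dimensional dual of KL minimization over a Wasserstein ball. *)
Section dual.
Variables (mu : {measure set T -> \bar R}) (D : set T) (c : T -> T -> R).
Variables (s r : R) (q : T -> R) (n : nat) (omega : 'I_n.+1 -> T).
Implicit Types (lam : R) (u : 'I_n.+1 -> R).

Definition cost lam u (x : T) : R :=
  let F j := (lam * (c x (omega j)) `^ s - u j)%R in
  \big[Num.min/F ord0]_(j < n.+1) F j.

Definition eta lam u : R :=
  fine (\int[mu]_(x in D) (q x * expR (- cost lam u x))%:E).

Definition dual_objective lam u : R :=
  (- lam * r `^ s + n.+1%:R^-1 * \sum_(j < n.+1) u j - ln (eta lam u))%R.

Definition dual_maximizer lam u : Prop :=
  (0 <= lam)%R /\
  forall lam' u', (0 <= lam')%R ->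
    (dual_objective lam' u' <= dual_objective lam u)%R.

(** The log-likelihood ratio log (p*/q), given by its closed form on the whole
    sample space, including the points where [q] vanishes. *)
Definition llr lam u (x : T) : R := (- cost lam u x - ln (eta lam u))%R.

End dual.

Definition KL_minimizer (Q : probability T R) (C : set (probability T R)) P :
  Prop := C P /\ forall P', C P' -> KL P Q <= KL P' Q.

End uncertainty_sets.

(** * Conditional expectation *)

Section conditional_expectation.
Context {disp : measure_display} {Omega : measurableType disp} {R : realType}.
Implicit Types (Pr : probability Omega R) (G : set (set Omega)).

Definition is_cond_exp Pr G (f g : Omega -> \bar R) : Prop :=
  [/\ (forall B : set (\bar R), measurable B -> G (g @^-1` B)),
      (forall w, 0 <= g w) &
      forall A, G A -> \int[Pr]_(w in A) g w = \int[Pr]_(w in A) f w].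

(** A version of E[f | G], for [f] nonnegative and possibly infinite; that one
    exists is [cond_exp_exists] below. *)
Definition cond_exp Pr G (f : Omega -> \bar R) : Omega -> \bar R :=
  xget (cst 0) [set g | is_cond_exp Pr G f g].

Section existence.
Variables (Pr : probability Omega R) (E : set (set Omega)).
Hypothesis mE : E `<=` measurable.

Let Omega' := g_sigma_algebraType E.

Let mid : measurable_fun setT (fun w : Omega => w : Omega').
Proof.
move=> _ B mB; rewrite setTI; apply: (@smallest_sub _ _ _ measurable) mB => //.
exact: sigma_algebra_measurable.
Qed.

Let mG (A : set Omega) : <<s E>> A -> measurable A.
Proof. by move=> GA; rewrite -[A]setTI; exact: mid. Qed.

Lemma bounded_cond_exp (f : Omega -> \bar R) :
  measurable_fun setT f -> (forall w, 0 <= f w <= 1) ->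
  exists g, is_cond_exp Pr <<s E>> f g.
Proof.
move=> mf f01.
have f0 w : 0 <= f w by have /andP[] := f01 w.
have f1 w : f w <= 1 by have /andP[] := f01 w.
pose nu (A : set Omega') := \int[Pr]_(w in A) f w.
have nu0 : nu set0 = 0 by rewrite /nu integral_set0.
have nu_ge0 A : 0 <= nu A by apply: integral_ge0.
have nus : semi_sigma_additive nu.
  move=> F mF tF mUF.
  exact: (semi_sigma_additive_nng_induced mf f0 (fun i => mG (mF i)) tF (mG mUF)).
pose nuM := isMeasure.Build _ _ _ nu nu0 nu_ge0 nus.
pose nu' : {measure set Omega' -> \bar R} := HB.pack nu nuM.
have nufin : fin_num_fun nu'.
  move=> A mA; rewrite ge0_fin_numE//.
  apply: (@le_lt_trans _ _ (\int[Pr]_(w in A) cst 1 w)).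
    apply: ge0_le_integral => //; first exact: mG.
    exact: measurable_funTS.
  rewrite integral_cst//; last exact: mG.
  by rewrite mul1e (le_lt_trans (probability_le1 _ _)) ?ltry//; exact: mG.
pose nuF := Measure_isFinite.Build _ _ _ nu' nufin.
pose nu'' : {finite_measure set Omega' -> \bar R} := HB.pack nu nuM nuF.
pose Pr' (A : set Omega') := pushforward Pr (fun w : Omega => w : Omega') A.
have Pr'0 : Pr' set0 = 0 by exact: (measure0 Pr).
have Pr'_ge0 A : 0 <= Pr' A by exact: (measure_ge0 Pr).
have Pr's : semi_sigma_additive Pr'.
  move=> F mF tF mUF; apply: (@measure_semi_sigma_additive _ _ _ Pr) => //.
    by move=> i; exact: (mG (mF i)).
  exact: (mG mUF).
pose PrM := isMeasure.Build _ _ _ Pr' Pr'0 Pr'_ge0 Pr's.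
pose PrP := Measure_isProbability.Build _ _ _
  (HB.pack_for {measure set Omega' -> \bar R} Pr' PrM) (probability_setT Pr).
pose Pr'' : probability Omega' R := HB.pack Pr' PrM PrP.
have nuPr : nu'' `<< (Pr'' : {sigma_finite_measure set Omega' -> \bar R}).
  apply/null_content_dominatesP => A mA PA0.
  rewrite /= /nu; apply: null_set_integral => //; first exact: mG.
  exact: measurable_funTS.
have [g [g0 _ ig nug]] := radon_nikodym_sigma_finite nuPr.
have mg : measurable_fun (setT : set Omega') g := measurable_int _ ig.
exists g; split=> //.
  by move=> B mB; rewrite -[X in <<s E>> X]setTI; exact: mg.
move=> A GA; rewrite [RHS](nug A GA).
by rewrite (ge0_integral_pushforward mid)//; exact: measurable_funTS.
Qed.

Lemma cond_exp_exists (f : Omega -> \bar R) :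
  measurable_fun setT f -> (forall w, 0 <= f w) ->
  is_cond_exp Pr <<s E>> f (cond_exp Pr <<s E>> f).
Proof.
move=> mf f0; rewrite /cond_exp; apply: xgetPex.
pose t k w := mine (f w) k%:R%:E.
have t_fin k w : t k w \is a fin_num.
  rewrite ge0_fin_numE ?le_min ?f0 ?lee_fin ?ler0n//.
  by rewrite gt_min ltry orbT.
have mt k : measurable_fun setT (t k) by exact: measurable_mine.
pose df k w := t k.+1 w - t k w.
have mdf k : measurable_fun setT (df k) by exact: emeasurable_funB.
have df01 k w : 0 <= df k w <= 1.
  rewrite /df; have := t_fin k w; have := t_fin k.+1 w; rewrite /t.
  have := f0 w; case: (f w) => [x x0|_|//].
    rewrite -!EFin_min => _ _; rewrite -EFinB !lee_fin -natr1 /Num.min.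
    by case: ifPn; case: ifPn; rewrite -?leNgt => h1 h2; apply/andP; split; lra.
  rewrite !minye => _ _; rewrite -EFinB !lee_fin -natr1.
  by apply/andP; split; lra.
have df0 k w : 0 <= df k w by have /andP[] := df01 k w.
have sumdf w : \sum_(k <oo) df k w = f w.
  have E1 n : \sum_(0 <= k < n) df k w = t n w.
    elim: n => [|n IH].
      by rewrite big_nil /t; apply/esym/min_idPr.
    by rewrite big_nat_recr//= IH /df /= addeC subeK//; exact: t_fin.
  under eq_fun do rewrite E1.
  apply/cvg_lim => //; rewrite /t; have := f0 w.
  case: (f w) => [x x0|_|//].
    apply: cvg_near_cst; near=> n; apply/min_idPl; rewrite lee_fin.
    by near: n; exact: nbhs_infty_ger.
  under eq_fun do rewrite minye.
  exact/cvgenyP.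
have [g gP] := choice (fun k => bounded_cond_exp (mdf k) (df01 k)).
have gm k : measurable_fun (setT : set Omega') (g k).
  by move=> _ B mB; rewrite setTI; have [+ _ _] := gP k; apply.
have g0 k w : 0 <= g k w by have [_ + _] := gP k; apply.
exists (fun w => \sum_(k <oo) g k w); split.
- have mg : measurable_fun (setT : set Omega') (fun w => \sum_(k <oo) g k w).
    by apply: ge0_emeasurable_sum => // k w _ _; exact: g0.
  by move=> B mB; rewrite -[X in <<s E>> X]setTI; exact: mg.
- by move=> w; apply: nneseries_ge0.
move=> A GA; have mA := mG GA.
rewrite integral_nneseries//; last first.
  move=> k; apply: (measurable_funS measurableT) => //.
  have := measurableT_comp (gm k) mid; exact.
under [in RHS]eq_integral do rewrite -sumdf.
rewrite integral_nneseries//; last by move=> k; exact: measurable_funTS.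
by apply: eq_eseriesr => k _; have [_ _ +] := gP k; apply.
Unshelve. all: by end_near.
Qed.

End existence.

End conditional_expectation.

(** * Change-point model and sequential tests *)

(** [X k] is the k-th observation, for k >= 1; [X 0] is not used. *)
Section change_point.
Context {dT dO : measure_display} {T : measurableType dT}.
Context {Omega : measurableType dO} {R : realType}.
Implicit Types (X : nat -> {mfun Omega >-> T}) (Pr : probability Omega R).

Definition independent_with_laws Pr X (law : nat -> probability T R) : Prop :=
  (forall (J : {fset nat}) (A : nat -> set T),
     (forall k, k \in J -> (1 <= k)%N) -> (forall k, measurable (A k)) ->
     Pr (\bigcap_(k in [set` J]) (X k @^-1` A k)) =
     \prod_(k <- J) Pr (X k @^-1` A k)) /\
  (forall k A, (1 <= k)%N -> measurable A -> Pr (X k @^-1` A) = law k A).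

(** [Pr_inf] is the law without change; [Pr_chg P nu] is the law when the
    distribution changes from [Q] to [P] at time [nu]. *)
Definition change_point_model (D : set T) (Q : probability T R) X
    (Pr_inf : probability Omega R)
    (Pr_chg : probability T R -> nat -> probability Omega R) : Prop :=
  [/\ (forall k w, (1 <= k)%N -> D (X k w)),
      independent_with_laws Pr_inf X (fun=> Q) &
      forall (P : probability T R) (nu : nat), P D = 1 -> (1 <= nu)%N ->
        independent_with_laws (Pr_chg P nu) X
          (fun k => if (k < nu)%N then Q else P)].

Definition natural_filtration X (k : nat) : set (set Omega) :=
  <<s \bigcup_(i in [set i | (1 <= i <= k)%N])
        preimage_set_system setT (X i) measurable >>.

Definition stopping_time (F : nat -> set (set Omega)) (tau : Omega -> \bar R) :
  Prop :=
  (forall w, tau w = +oo \/ exists k : nat, tau w = k%:R%:E) /\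
  forall k : nat, F k [set w | tau w <= k%:R%:E].

Definition test_class X (Pr_inf : probability Omega R) (gamma : R) :
    set (Omega -> \bar R) :=
  [set tau | stopping_time (natural_filtration X) tau /\
             gamma%:E <= \int[Pr_inf]_w tau w].

(** [Pr nu] is the law when the change-point is [nu]. *)
Definition WADD X (Pr : nat -> probability Omega R) (tau : Omega -> \bar R) :
    \bar R :=
  ereal_sup [set ess_sup (Pr nu)
      (cond_exp (Pr nu) (natural_filtration X nu.-1)
         (fun w => maxe (tau w - nu%:R%:E + 1) 0))
    | nu in [set nu | (1 <= nu)%N]].

Fixpoint cusum X (l : T -> R) (k : nat) (w : Omega) : R :=
  if k is k'.+1 then (Num.max (cusum X l k' w) 0 + l (X k w))%R else 0%R.

Definition tau_DR X (M : nat) (l : 'I_M -> T -> R) (b : R) (w : Omega) : \bar R :=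
  ereal_inf [set k%:R%:E | k in
    [set k : nat | (1 <= k)%N /\
       b%:E <= \big[maxe/-oo]_(m < M) (cusum X (l m) k w)%:E]].

End change_point.

(* Main.v *)
Require Import Defs.
From HB Require Import structures.
From mathcomp Require Import all_boot all_order all_algebra finmap.
From mathcomp Require Import all_classical all_reals all_analysis.
From mathcomp Require Import measurable_realfun ess_sup_inf.
From mathcomp Require Import lra ring zify.

(** A CuSum statistic with log-likelihood ratio [l] detects a change to [P] with
    delay about [threshold / \int l dP], and no test does better than
    [ln gamma / KL].  The theorem holds because the least favorable
    distribution [P*] of a ball makes these two rates meet: its log-likelihood
    ratio [l = ln (p*/q)] satisfies [\int l dP >= \int l dP* = KL P* Q] for all
    [P] in the ball.

    This inequality is convex duality.  Let [V] be the maximal value of the dual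
    objective.  Integrating the pointwise inequality that defines [l] against a
    coupling of [P] with the empirical measure gives [\int l dP >= V]
    ([weak_duality]).  Comparing the maximizer [(lam, u)] with the multiples
    [((1 - h) lam, (1 - h) u)] gives [\int exp (- h l) dP* >= exp (- h V)] for
    small [h >= 0], whence [\int l dP* <= V] on letting [h] tend to 0
    ([scaling_lower_bound], [entropy_le_of_scaling]).  Moreover [KL P* Q] is
    positive because [P*] lies in the ball and [Q] does not.

    For the test itself, [l] is bounded above, so it overshoots the threshold
    by a constant [K] at most, and Wald's identity bounds the delay by
    [(threshold + K) / KL], uniformly over the ball and over the past
    ([delay_sum_le], [WADD_tau_DR_le]).  The bound on the false alarms compares
    [exp] of the CuSum with the Shiryaev-Roberts statistic, whose compensator
    is the time ([average_run_length_ge]).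

    For the lower bound, let [tau] have run length at least [gamma] without
    change, and let [D] bound its delays after a change to [P*].  Among all
    windows of length [m] there is one in which, without change, [tau] stops
    with conditional probability at most [2 m / gamma] ([quiet_window]).  Under
    a change at the start of this window, [tau] stops in it with conditional
    probability at least [1 - D / m].  The log-likelihood ratio accumulated
    until [tau] has to account for this discrepancy, yet its mean is at most
    [D * KL] by Wald's identity.  A tangent inequality for the exponential
    ([stopped_tangent]) makes this precise and yields the bound of
    [WADD_information_bound]; taking [m] of order [(ln gamma) `^ (3/2)] turns
    it into [D >= ln gamma / KL * (1 + o(1))]. *)

Set Implicit Arguments.
Unset Strict Implicit.
Unset Printing Implicit Defensive.

Import Order.TTheory GRing.Theory Num.Theory.
Import numFieldNormedType.Exports.

Local Open Scope classical_set_scope.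
Local Open Scope ring_scope.
Local Open Scope charge_scope.
Local Open Scope ereal_scope.

(** * Integration against densities and product laws *)

Import HBNNSimple.

Section integration.
Context {d} {T : measurableType d} {R : realType}.

(** The density is an explicit real function, unlike the Radon-Nikodym
    derivative, since likelihood ratios below are given pointwise. *)
Lemma ge0_integral_density (m1 m2 : {measure set T -> \bar R})
    (p : T -> R) (f : T -> \bar R) :
  measurable_fun setT p -> (forall x, 0 <= p x)%R ->
  (forall A, measurable A -> m1 A = \int[m2]_(x in A) (p x)%:E) ->
  measurable_fun setT f -> (forall x, 0 <= f x) ->
  \int[m1]_x f x = \int[m2]_x (f x * (p x)%:E).
Proof.
move=> mp p0 m1E mf f0.
have mp' : measurable_fun setT (EFin \o p) by exact/measurable_EFinP.
pose g := nnsfun_approx measurableT mf.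
have gp_cvg x : (g n x)%:E * (p x)%:E @[n --> \oo] --> f x * (p x)%:E.
  apply: cvgeZr => //.
  exact: (@cvg_nnsfun_approx _ _ _ _ measurableT f mf (fun x _ => f0 x) x I).
have ndg x : {homo (fun n => (g n x)%:E) : a b / (a <= b)%N >-> a <= b}.
  by move=> a b ab; rewrite lee_fin; exact/lefP/nd_nnsfun_approx.
transitivity (limn (fun n => \int[m1]_x (g n x)%:E)).
  rewrite -monotone_convergence//=; last 2 first.
  - by move=> n; exact/measurable_EFinP.
  - by move=> n x _; rewrite lee_fin.
  apply: eq_integral => x _; apply/esym/cvg_lim => //.
  exact: (@cvg_nnsfun_approx _ _ _ _ measurableT f mf (fun x _ => f0 x) x I).
transitivity (limn (fun n => \int[m2]_x ((g n x)%:E * (p x)%:E))); last first.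
  rewrite -monotone_convergence//=; last 3 first.
  - by move=> n; apply: emeasurable_funM => //; exact/measurable_EFinP.
  - by move=> n x _; rewrite mule_ge0// lee_fin.
  - by move=> x _ a b ab; apply: lee_wpmul2r; [rewrite lee_fin|exact: ndg].
  by apply: eq_integral => x _; apply/cvg_lim => //; exact: gp_cvg.
congr (limn _); apply/funext => n.
under [in LHS]eq_integral do rewrite fimfunE -fsumEFin//.
rewrite ge0_integral_fsum//; last 2 first.
  - by move=> r; exact/measurable_EFinP/measurableT_comp.
  - by move=> r x _; rewrite EFinM nnfun_muleindic_ge0.
under [in RHS]eq_integral.
  move=> x _; rewrite fimfunE -fsumEFin// ge0_mule_fsuml; last first.
    by move=> r; rewrite EFinM nnfun_muleindic_ge0.
  over.
rewrite ge0_integral_fsum//; last 2 first.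
  - move=> r; apply: emeasurable_funM => //.
    exact/measurable_EFinP/measurableT_comp.
  - by move=> r x _; apply: mule_ge0; [exact: nnfun_muleindic_ge0|rewrite lee_fin].
apply: eq_fsbigr => r /set_mem[x _ <-].
under [in RHS]eq_integral do rewrite EFinM -muleA.
rewrite ge0_integralZl//; last 3 first.
  - by apply: emeasurable_funM => //; exact/measurable_EFinP.
  - by move=> y _; rewrite mule_ge0// lee_fin.
  - by rewrite lee_fin.
under [in LHS]eq_integral do rewrite EFinM.
rewrite ge0_integralZl//; last 2 first.
  - exact/measurable_EFinP.
  - by rewrite lee_fin.
congr (_ * _); rewrite integral_indic// setIT m1E//.
rewrite [LHS]integral_mkcond; apply: eq_integral => y _.
by rewrite patchE indicE; case: ifPn => _; rewrite ?mul1e ?mul0e.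
Qed.

End integration.

Section product.
Context {dT dO} {T : measurableType dT} {Omega : measurableType dO} {R : realType}.

(** The joint law of [h] and [Y] is the product of their laws, so the identity
    is Tonelli's theorem on the product space. *)
Lemma independent_integralM (Pr : probability Omega R) (law : probability T R)
    (h : Omega -> \bar R) (Y : {mfun Omega >-> T}) (g : T -> \bar R) :
  measurable_fun setT h -> (forall w, 0 <= h w) ->
  measurable_fun setT g -> (forall x, 0 <= g x) ->
  (forall B A, measurable B -> measurable A ->
     Pr (h @^-1` B `&` Y @^-1` A) = Pr (h @^-1` B) * law A) ->
  \int[Pr]_w (h w * g (Y w)) = \int[Pr]_w h w * \int[law]_x g x.
Proof.
move=> mh h0 mg g0 ind.
have mhY : measurable_fun setT (fun w => (h w, Y w)).
  by apply/measurable_fun_pairP; split => //; exact: measurable_funPT.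
pose hm := mfun_Sub (mem_set mh : h \in mfun).
pose hYm := mfun_Sub (mem_set mhY : (fun w => (h w, Y w)) \in mfun).
have prodE A : measurable A ->
    (distribution Pr hm \x law) A = distribution Pr hYm A.
  by move=> mA; exact: product_measure_unique.
(* The maximum with 0 makes the integrand nonnegative off the range of [h]. *)
have mprod : measurable_fun setT (fun z : \bar R * T => maxe z.1 0 * g z.2).
  apply: emeasurable_funM.
    by apply: measurable_maxe => //; exact: measurable_fst.
  exact: (measurableT_comp mg measurable_snd).
have prod0 z : 0 <= maxe z.1 0 * g z.2 by rewrite mule_ge0// le_max lexx orbT.
transitivity (\int[distribution Pr hYm]_z (maxe z.1 0 * g z.2)).
  rewrite ge0_integral_distribution//; apply: eq_integral => w _ /=.
  by rewrite (max_idPl (h0 w)).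
transitivity (\int[distribution Pr hm \x law]_z (maxe z.1 0 * g z.2)).
  by apply: eq_measure_integral => A mA _; exact: esym (prodE A mA).
rewrite fubini_tonelli1// /fubini_F/=.
under eq_integral do rewrite ge0_integralZl ?le_max ?lexx ?orbT//.
rewrite ge0_integralZr//; last 3 first.
- exact: measurable_maxe.
- by move=> x _; rewrite le_max lexx orbT.
- exact: integral_ge0.
congr (_ * _); rewrite ge0_integral_distribution//.
- by apply: eq_integral => w _ /=; rewrite (max_idPl (h0 w)).
- exact: measurable_maxe.
- by move=> x; rewrite le_max lexx orbT.
Qed.

End product.

(** * The natural filtration, independence and change of measure *)

Section filtration.
Context {dT dO} {T : measurableType dT} {Omega : measurableType dO} {R : realType}.
Variable X : nat -> {mfun Omega >-> T}.

Let gens n := \bigcup_(i in [set i | (1 <= i <= n)%N])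
  preimage_set_system setT (X i) measurable.

(** [Omega] with the [n]-th sigma-algebra of the filtration: being measurable
    with respect to the first [n] observations is being a measurable function
    on this type, so the closure properties of the latter apply. *)
Definition filtered n := g_sigma_algebraType (gens n).

Lemma sub_gens n : gens n `<=` @measurable _ Omega.
Proof. by move=> A [i _ [B mB <-]]; exact: measurable_funPT. Qed.

Lemma natural_filtration_measurable n (C : set Omega) :
  natural_filtration X n C -> measurable C.
Proof.
move=> FC; apply: (@smallest_sub _ _ _ measurable) FC; last exact: sub_gens.
exact: sigma_algebra_measurable.
Qed.

Lemma natural_filtration_le (m n : nat) : (m <= n)%N ->
  natural_filtration X m `<=` natural_filtration X n.
Proof.
move=> mn; apply: sub_sigma_algebra2 => A [i /= /andP[i1 im] XA].
by exists i => //=; rewrite i1 (leq_trans im).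
Qed.

Lemma filtered_measurable_fun n d' (S : measurableType d') (f : filtered n -> S) :
  measurable_fun setT f -> measurable_fun (setT : set Omega) (f : Omega -> S).
Proof.
move=> mf _ B mB; rewrite setTI; apply: (@natural_filtration_measurable n).
by rewrite -[X in natural_filtration _ _ X]setTI; exact: mf.
Qed.

Lemma filtered_measurable_fun_le (m n : nat) d' (S : measurableType d')
    (f : Omega -> S) : (m <= n)%N ->
  measurable_fun (setT : set (filtered m)) f ->
  measurable_fun (setT : set (filtered n)) f.
Proof.
move=> mn mf _ B mB; rewrite setTI; apply: (natural_filtration_le mn).
by rewrite -[X in natural_filtration _ _ X]setTI; exact: mf.
Qed.

Lemma filtered_observation n k d' (S : measurableType d') (g : T -> S) :
  (1 <= k <= n)%N -> measurable_fun setT g ->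
  measurable_fun (setT : set (filtered n)) (fun w => g (X k w)).
Proof.
move=> kn mg _ B mB; rewrite setTI; apply: sub_gen_smallest.
exists k => //; exists (g @^-1` B); last by rewrite setTI.
by rewrite -[X in measurable X]setTI; exact: mg.
Qed.

Definition cylinder (A : nat -> set T) n : set Omega :=
  [set w | forall k, (1 <= k <= n)%N -> A k (X k w)].

Lemma cylinderS A n : cylinder A n.+1 = cylinder A n `&` X n.+1 @^-1` A n.+1.
Proof.
apply/seteqP; split=> [w AX|w [AX AXn] k /andP[k1]].
  split; last by apply: AX; rewrite ltnSn.
  by move=> k /andP[k1 kn]; apply: AX; rewrite k1 leqW.
by rewrite leq_eqVlt => /predU1P[->//|kn]; apply: AX; rewrite k1.
Qed.

Lemma cylinder0 A : cylinder A 0 = setT.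
Proof. by apply/seteqP; split=> // w _ [|k]. Qed.

Lemma measurable_cylinder A n : (forall k, measurable (A k)) ->
  natural_filtration X n (cylinder A n).
Proof.
move=> mA; elim: n => [|n IH].
  by rewrite cylinder0; exact: (@measurableT _ (filtered 0)).
rewrite cylinderS; apply: (@measurableI _ (filtered n.+1)).
  exact: (natural_filtration_le (leqnSn n)).
apply: sub_gen_smallest; exists n.+1; first by rewrite /= leqnn.
by exists (A n.+1); rewrite ?setTI.
Qed.

(** Cylinders are stable under intersection and generate the [n]-th
    sigma-algebra, so this is Dynkin's pi-lambda theorem. *)
Lemma cylinder_measure_unique n (m1 m2 : {measure set Omega -> \bar R}) :
  (m1 setT < +oo) ->
  (forall A, (forall k, measurable (A k)) ->
     m1 (cylinder A n) = m2 (cylinder A n)) ->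
  forall C, natural_filtration X n C -> m1 C = m2 C.
Proof.
move=> m1oo m12.
pose G := [set cylinder A n | A in [set A | forall k, measurable (A k)]].
have sG C : natural_filtration X n C -> <<s G >> C.
  apply: smallest_sub; first exact: smallest_sigma_algebra.
  move=> B [i /= /andP[i1 iN] [A mA <-]]; apply: sub_gen_smallest.
  exists (fun k => if k == i then A else setT); first by move=> k /=; case: ifP.
  apply/seteqP; split=> [w /(_ i)|w]; rewrite setTI.
    by rewrite i1 iN eqxx; apply.
  by move=> Aw k _; case: eqP => [->|].
move=> C /sG; apply: (@g_sigma_algebra_measure_unique _ _ _ G _ (fun=> setT)).
- move=> _ [A mA <-]; apply: (@natural_filtration_measurable n).
  exact: measurable_cylinder.
- move=> _; exists (fun=> setT) => //.
  by apply/seteqP; split.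
- by apply/seteqP; split=> // w _; exists 0%N.
- move=> _ _ [A mA <-] [B mB <-]; exists (fun k => A k `&` B k).
    by move=> k; exact: measurableI.
  apply/seteqP; split=> [w AB|w [Aw Bw] k kn].
    by split=> k /AB[].
  by split; [exact: Aw|exact: Bw].
- by move=> _ [A mA <-]; exact: m12.
- by [].
Qed.

Section independence.
Variables (Pr : probability Omega R) (law : nat -> probability T R).
Hypothesis XPr : independent_with_laws Pr X law.

Lemma probability_cylinder A n : (forall k, measurable (A k)) ->
  Pr (cylinder A n) = \prod_(1 <= k < n.+1) law k (A k).
Proof.
move=> mA; have [ind lawE] := XPr.
pose J := [fset k | k in iota 1 n]%fset.
have JE k : (k \in J) = (1 <= k <= n)%N.
  by rewrite in_fset/= mem_iota add1n ltnS.
have -> : cylinder A n = \bigcap_(k in [set` J]) (X k @^-1` A k).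
  apply/seteqP; split=> [w Aw k /=|w Aw k kn]; first by rewrite JE; exact: Aw.
  by apply: Aw; rewrite /= JE.
rewrite ind//; last by move=> k; rewrite JE => /andP[].
rewrite (perm_big (iota 1 n)); last first.
  apply: uniq_perm; [exact: fset_uniq|exact: iota_uniq|].
  by move=> k; rewrite JE mem_iota add1n ltnS.
rewrite /index_iota subSS subn0 big_seq_cond [RHS]big_seq_cond.
apply: eq_bigr => k; rewrite andbT mem_iota => /andP[k1 _].
exact: lawE.
Qed.

(** The product formula extends from cylinders to the whole sigma-algebra of
    the past, both sides being finite measures in [C]. *)
Lemma filtration_independent n C A : natural_filtration X n C ->
  measurable A -> Pr (C `&` X n.+1 @^-1` A) = Pr C * law n.+1 A.
Proof.
move=> FC mA.
have mXA : measurable (X n.+1 @^-1` A).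
  by rewrite -[X in measurable X]setTI; exact: measurable_funPT.
have laA : law n.+1 A \is a fin_num by exact: fin_num_measure.
pose c : {nonneg R} := NngNum (fine_ge0 (measure_ge0 (law n.+1) A)).
have cE : c%:num%:E = law n.+1 A by rewrite /= fineK.
suff : mrestr Pr mXA C = mscale c Pr C.
  by rewrite {1}/mrestr => ->; rewrite /mscale cE muleC.
apply: (@cylinder_measure_unique n) FC.
  by rewrite /= /mrestr setTI (le_lt_trans (probability_le1 _ _))// ltry.
move=> B mB; have [ind lawE] := XPr.
rewrite /= /mrestr /mscale cE.
pose B' k := if k == n.+1 then A else B k.
have mB' k : measurable (B' k) by rewrite /B'; case: ifP.
have BB' : cylinder B n = cylinder B' n.
  apply/seteqP; split=> w Bw k kn; have := Bw k kn; rewrite /B' ifF//;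
  by case/andP: kn => _; rewrite leqNgt; apply: contraNF => /eqP ->.
have -> : A = B' n.+1 by rewrite /B' eqxx.
rewrite BB' -cylinderS probability_cylinder//.
rewrite big_nat_recr//= muleC; congr (_ * _).
exact/esym/probability_cylinder.
Qed.

Lemma filtration_independent_integral n (h : Omega -> \bar R) (g : T -> \bar R) :
  measurable_fun (setT : set (filtered n)) h -> (forall w, 0 <= h w) ->
  measurable_fun setT g -> (forall x, 0 <= g x) ->
  \int[Pr]_w (h w * g (X n.+1 w)) = \int[Pr]_w h w * \int[law n.+1]_x g x.
Proof.
move=> mh h0 mg g0; apply: independent_integralM => //.
  exact: filtered_measurable_fun mh.
move=> B A mB mA; apply: filtration_independent => //.
by rewrite -[X in natural_filtration _ _ X]setTI; exact: mh.
Qed.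

End independence.

Section likelihood_ratio.
Variables (P1 P2 : probability Omega R) (law1 law2 : nat -> probability T R).
Hypothesis XP1 : independent_with_laws P1 X law1.
Hypothesis XP2 : independent_with_laws P2 X law2.
Variable W : nat -> T -> R.
Hypothesis mW : forall k, measurable_fun setT (W k).
Hypothesis W0 : forall k x, (0 <= W k x)%R.
Hypothesis lawW : forall k A, (1 <= k)%N -> measurable A ->
  law1 k A = \int[law2 k]_(x in A) (W k x)%:E.

Definition likelihood n w : R := (\prod_(1 <= k < n.+1) W k (X k w))%R.

Lemma likelihood_ge0 n w : (0 <= likelihood n w)%R.
Proof. exact: prodr_ge0. Qed.

Lemma measurable_likelihood n :
  measurable_fun (setT : set (filtered n)) (likelihood n).
Proof.
elim: n => [|n IH].
  rewrite /likelihood; under eq_fun do rewrite big_geq//.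
  exact: measurable_cst.
rewrite /likelihood; under eq_fun do rewrite big_nat_recr//=.
apply: measurable_funM.
  exact: filtered_measurable_fun_le IH.
by apply: filtered_observation => //; rewrite /= leqnn.
Qed.

(** On cylinders both sides are products over the observations, by
    independence; the general case follows since cylinders determine finite
    measures. *)
Lemma change_of_measure n C : natural_filtration X n C ->
  P1 C = \int[P2]_(w in C) (likelihood n w)%:E.
Proof.
have mlik : measurable_fun setT (EFin \o likelihood n : Omega -> \bar R).
  exact/measurable_EFinP/(filtered_measurable_fun (@measurable_likelihood n)).
have lik0 w : 0 <= (EFin \o likelihood n) w by rewrite lee_fin likelihood_ge0.
pose nu C := \int[P2]_(w in C) (EFin \o likelihood n) w.
have nu0 : nu set0 = 0 by rewrite /nu integral_set0.
have nu_ge0 A : 0 <= nu A by apply: integral_ge0.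
have nus : semi_sigma_additive nu.
  by move=> F mF tF mUF; exact: (semi_sigma_additive_nng_induced mlik lik0).
pose nuM := isMeasure.Build _ _ _ nu nu0 nu_ge0 nus.
pose nu' : {measure set Omega -> \bar R} := HB.pack nu nuM.
move=> FC; apply: (@cylinder_measure_unique n P1 nu') => //.
  by rewrite (le_lt_trans (probability_le1 _ _))// ltry.
move=> A mA; rewrite -[LHS]/(P1 (cylinder A n)) (probability_cylinder XP1)//.
rewrite -[RHS]/(nu (cylinder A n)) /nu {mlik lik0 nu nu0 nu_ge0 nus nuM nu' FC}.
elim: n => [|n IH].
  rewrite cylinder0 big_geq// /likelihood.
  under eq_integral do rewrite /= big_geq//.
  by rewrite integral_cst// mul1e; exact/esym/probability_setT.
rewrite big_nat_recr//= IH lawW//.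
rewrite [X in _ * X]integral_mkcond [X in X * _]integral_mkcond.
rewrite -(filtration_independent_integral XP2); first last.
- by move=> x; rewrite patchE; case: ifPn => // _; rewrite lee_fin.
- apply/measurable_restrict => //; apply: measurable_funTS.
  exact/measurable_EFinP.
- by move=> x; rewrite patchE; case: ifPn => // _; rewrite lee_fin likelihood_ge0.
- have mc : measurable (cylinder A n : set (filtered n)) by exact: measurable_cylinder.
  apply/(measurable_restrictT _ mc).
  apply: measurable_funTS.
  by apply/measurable_EFinP; exact: measurable_likelihood.
rewrite [RHS]integral_mkcond; apply: eq_integral => w _.
rewrite cylinderS !patchE in_setI /= [in RHS]/likelihood big_nat_recr//=.
have -> : (w \in X n.+1 @^-1` A n.+1) = (X n.+1 w \in A n.+1).
  by apply/idP/idP; rewrite !inE.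
case: (w \in cylinder A n) => /=; last exact: mul0e.
by case: ifPn => _ //; exact: mule0.
Qed.

End likelihood_ratio.
End filtration.

(** * Detection delay and the worst-case criterion *)

Section cond_exp_bound.
Context {dO} {Omega : measurableType dO} {R : realType}.
Variables (Pr : probability Omega R) (E : set (set Omega)).
Hypothesis mE : E `<=` measurable.

(** Replaces the conditional expectation by inequalities between integrals over
    the events of the past, the form in which both bounds on the delay are
    proved.  If a version exceeded [B + e] on a non-null event, integrating
    over this event would contradict the right-hand side. *)
Lemma ess_sup_cond_exp_leP (f : Omega -> \bar R) (B : R) :
  measurable_fun setT f -> (forall w, 0 <= f w) -> (0 <= B)%R ->
  ess_sup Pr (cond_exp Pr <<s E>> f) <= B%:E <->
  (forall A, <<s E>> A -> \int[Pr]_(w in A) f w <= B%:E * Pr A).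
Proof.
move=> mf f0 B0.
have [mg g0 gE] := cond_exp_exists Pr mE mf f0.
set g := cond_exp _ _ _ in mg g0 gE *.
have mG (A : set Omega) : <<s E>> A -> measurable A.
  apply: smallest_sub => //; exact: sigma_algebra_measurable.
have mg' : measurable_fun setT g.
  by move=> _ C mC; rewrite setTI; apply: mG; exact: mg.
split=> [/ess_supP gB A GA|fB].
  rewrite -gE// -integral_cst; last exact: mG.
  apply: ae_ge0_le_integral => //; first exact: mG.
  - exact: measurable_funTS.
  - by apply: filterS gB => w gw _.
apply/lee_addgt0Pr => e e0; apply/ess_supP.
pose A := g @^-1` [set x | (B + e)%:E < x].
have GA : <<s E>> A.
  apply: mg; rewrite (_ : [set _ | _] = `](B + e)%:E, +oo[%classic).
    exact: emeasurable_itv.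
  by apply/seteqP; split=> x /=; rewrite in_itv/= andbT.
have mA := mG _ GA.
suff A0 : Pr A = 0.
  by exists A; split=> // w /= /negP; rewrite -EFinD -ltNge.
have PA : Pr A \is a fin_num by exact: fin_num_measure.
have : (B + e)%:E * Pr A <= B%:E * Pr A.
  apply: le_trans (fB _ GA); rewrite -gE// -integral_cst//.
  apply: ge0_le_integral => //.
  - by move=> w _; rewrite /= lee_fin addr_ge0// ltW.
  - exact: measurable_funTS.
  - by move=> w /ltW.
rewrite -(fineK PA) -!EFinM lee_fin => BA; congr EFin; apply/eqP.
rewrite eq_le fine_ge0// andbT.
have : (e * fine (Pr A) <= 0)%R by move: BA; rewrite mulrDl; lra.
by rewrite pmulr_rle0.
Qed.

End cond_exp_bound.

Section delay.
Context {dT dO} {T : measurableType dT} {Omega : measurableType dO} {R : realType}.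
Variable X : nat -> {mfun Omega >-> T}.
Variable tau : Omega -> \bar R.
Hypothesis tauP : stopping_time (natural_filtration X) tau.

Definition reached (k : nat) : set Omega := [set w | k%:R%:E <= tau w].

Lemma reachedS k : reached k.+1 = ~` [set w | tau w <= k%:R%:E].
Proof.
apply/seteqP; split=> w; rewrite /reached /=.
  by move=> kt /(le_trans kt); rewrite lee_fin ler_nat ltnn.
case: (tauP.1 w) => [->|[j ->]]; first by rewrite leey.
by move/negP; rewrite -ltNge lte_fin lee_fin ltr_nat ler_nat.
Qed.

Lemma natural_filtration_reached k : natural_filtration X k (reached k.+1).
Proof.
rewrite reachedS; apply: (@measurableC _ (filtered X k)).
exact: tauP.2.
Qed.

Lemma reached0 : reached 0 = setT.
Proof.
apply/seteqP; split=> // w _; rewrite /reached /=.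
by case: (tauP.1 w) => [->|[j ->]]; rewrite ?leey// lee_fin ler_nat.
Qed.

Lemma measurable_reached k : measurable (reached k).
Proof.
case: k => [|k]; first by rewrite reached0.
exact: (natural_filtration_measurable (@natural_filtration_reached k)).
Qed.

Lemma reached_le (j k : nat) : (j <= k)%N -> reached k `<=` reached j.
Proof. by move=> jk w; apply: le_trans; rewrite lee_fin ler_nat. Qed.

(** Layer-cake formula: a delay counts the times that [tau] reaches. *)
Lemma delayE (nu : nat) w :
  maxe (tau w - nu%:R%:E + 1) 0 = \sum_(k <oo) (\1_(reached (nu + k)) w)%:E.
Proof.
case: (tauP.1 w) => [tw|[j tw]].
  have -> : maxe (tau w - nu%:R%:E + 1) 0 = +oo by rewrite tw /= maxye.
  have E n : \sum_(0 <= k < n) (\1_(reached (nu + k)) w : R)%:E = n%:R%:E.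
    rewrite sumEFin; congr EFin; rewrite (eq_bigr (fun=> 1%R)).
      by rewrite big_const_nat iter_addr_0 subn0.
    by move=> k _; rewrite indicE mem_set// /reached /= tw leey.
  apply/esym; under eq_fun do rewrite E.
  apply/cvg_lim => //; apply/cvgenyP => //.
have E n : \sum_(0 <= k < n) (\1_(reached (nu + k)) w : R)%:E =
    (minn n (j.+1 - nu))%:R%:E.
  elim: n => [|n IH]; first by rewrite big_nil min0n.
  rewrite big_nat_recr//= IH -EFinD; congr EFin.
  have -> : \1_(reached (nu + n)) w = (nu + n <= j)%N%:R :> R.
    rewrite indicE; congr (_%:R); congr nat_of_bool; apply/idP/idP.
      by rewrite inE /reached /= tw lee_fin ler_nat.
    by move=> ?; rewrite inE /reached /= tw lee_fin ler_nat.
  rewrite -natrD; congr (_%:R)%R.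
  by have [h|h] := leqP (nu + n) j; rewrite /= ?addn1 ?addn0 !minnE; lia.
have -> : maxe (tau w - nu%:R%:E + 1) 0 = (j.+1 - nu)%:R%:E.
  rewrite tw -EFinB -EFinD -EFin_max; congr EFin.
  have [h|h] := leqP nu j.+1.
    by rewrite natrB// -natr1 addrAC; apply/max_idPl; rewrite subr_ge0 natr1 ler_nat.
  rewrite (eqP (ltnW h)); apply/max_idPr.
  by rewrite addrAC natr1 subr_le0 ler_nat ltnW.
apply/esym/cvg_lim => //; apply: cvg_near_cst; exists (j.+1 - nu)%N => // n /= nn.
by rewrite E (minn_idPr nn).
Qed.

Lemma delay_ge0 (nu : nat) w : 0 <= maxe (tau w - nu%:R%:E + 1) 0.
Proof. by rewrite le_max lexx orbT. Qed.

Lemma measurable_delay (nu : nat) :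
  measurable_fun setT (fun w => maxe (tau w - nu%:R%:E + 1) 0).
Proof.
under eq_fun do rewrite delayE.
apply: ge0_emeasurable_sum => // k _; apply/measurable_EFinP.
exact/measurable_indic/measurable_reached.
Qed.

Lemma integral_delay (Pr : probability Omega R) (nu : nat) A : measurable A ->
  \int[Pr]_(w in A) maxe (tau w - nu%:R%:E + 1) 0 =
  \sum_(k <oo) Pr (reached (nu + k) `&` A).
Proof.
move=> mA; under eq_integral do rewrite delayE.
rewrite integral_nneseries//; last first.
  move=> k; apply/measurable_EFinP/measurable_funTS.
  exact/measurable_indic/measurable_reached.
apply: eq_eseriesr => k _; rewrite integral_indic//.
exact: measurable_reached.
Qed.

Lemma integral_stopping_time (Pr : probability Omega R) :
  \int[Pr]_w tau w = \sum_(k <oo) Pr (reached k.+1).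
Proof.
transitivity (\int[Pr]_w maxe (tau w - 1%:R%:E + 1) 0).
  apply: eq_integral => w _; rewrite subeK//.
  by apply/esym/max_idPl; have := reached0; move/seteqP => [_ /(_ w I)].
by rewrite integral_delay//; apply: eq_eseriesr => k _; rewrite setIT.
Qed.

Lemma WADD_leP (Pr : nat -> probability Omega R) (B : R) : (0 <= B)%R ->
  WADD X Pr tau <= B%:E <->
  forall nu A, (1 <= nu)%N -> natural_filtration X nu.-1 A ->
    \sum_(k <oo) Pr nu (reached (nu + k) `&` A) <= B%:E * Pr nu A.
Proof.
move=> B0.
have key nu := ess_sup_cond_exp_leP (Pr nu) (@sub_gens _ _ _ _ X nu.-1)
  (measurable_delay nu) (delay_ge0 nu) B0.
split=> [WB nu A nu1 FA|H].
  rewrite -integral_delay; last exact: natural_filtration_measurable FA.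
  apply: (key nu).1 => //; apply: le_trans WB.
  by apply: ereal_sup_ubound; exists nu.
apply: ge_ereal_sup => _ [nu nu1 <-]; apply/(key nu) => A FA.
rewrite integral_delay; first exact: H.
exact: natural_filtration_measurable FA.
Qed.

End delay.

(** * Average run length: the Shiryaev-Roberts statistic *)

Section sums.
Context {R : realType}.

(** Here [u i] says that the test is still running before the [i]-th step, and
    the last sum is the log-likelihood ratio [x] accumulated until it stops or
    [m] steps are made.  For a test running at the start this is the tangent
    inequality [exp (y - x) >= 1 + y - x] if it stops within [m] steps and
    [exp (- x) >= 1 - x] if it does not. *)
Lemma stopped_tangent (u : nat -> bool) (l : nat -> R) (y : R) (m : nat) :
  (forall i, u i.+1 -> u i) ->
  ((u 0%N)%:R + y * \sum_(i < m) (u i && ~~ u i.+1)%:R <=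
   expR y * \sum_(i < m) (u i && ~~ u i.+1)%:R * expR (- \sum_(j < i.+1) l j)
   + (u m)%:R * expR (- \sum_(j < m) l j) + \sum_(i < m) (u i)%:R * l i)%R.
Proof.
move=> ud.
have ule i j : (i <= j)%N -> u j -> u i.
  by move=> /subnK <-; elim: (j - i)%N => // k IH /ud.
have all1 n : u n ->
    ((\sum_(i < n) (u i)%:R * l i)%R = (\sum_(i < n) l i)%R) /\
    (forall f : nat -> R, (\sum_(i < n) (u i && ~~ u i.+1)%:R * f i)%R = 0%R).
  move=> un; split=> [|f].
    by apply: eq_bigr => i _; rewrite (ule i n) ?mul1r// ltnW.
  by rewrite big1// => i _; rewrite (ule i.+1 n)// andbF mul0r.
have all1' n : u n -> (\sum_(i < n) (u i && ~~ u i.+1)%:R)%R = 0%R :> R.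
  by move=> un; rewrite big1// => i _; rewrite (ule i.+1 n)// andbF.
elim: m => [|m IH].
  by rewrite !big_ord0 oppr0 expR0 !mulr0 !addr0 add0r mulr1.
have [um1|um1] := boolP (u m.+1).
  have [-> h] := all1 _ um1.
  rewrite (h (fun i => expR (- \sum_(j < i.+1) l j))%R) all1'// (ule 0%N m.+1)//.
  rewrite !mulr0 addr0 add0r mul1r; set L := (\sum_(i < _) l i)%R.
  by rewrite /=; have := expR_ge1Dx (- L); lra.
have [um|um] := boolP (u m).
  rewrite !big_ord_recr/=; have [-> h] := all1 _ um.
  rewrite (h (fun i => expR (- \sum_(j < i.+1) l j))%R) all1'// (ule 0%N m)//.
  rewrite um um1 /= mul0r !add0r !mul1r mulr1 addr0 -expRD.
  set L := (\sum_(i < _) l i)%R.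
  by rewrite /=; have := expR_ge1Dx (y - (L + l m)); lra.
move: IH; rewrite !big_ord_recr/= (negbTE um) (negbTE um1)/=.
by rewrite !mul0r !addr0.
Qed.

Lemma sum_shift_le (f : nat -> R) (m N : nat) : (forall k, 0 <= f k)%R ->
  (\sum_(k < N) (f k - f (k + m)%N) <= \sum_(k < m) f k)%R.
Proof.
move=> f0; rewrite sumrB lerBlDr.
have -> : (\sum_(k < m) f k + \sum_(k < N) f (k + m)%N = \sum_(k < m + N) f k)%R.
  by rewrite big_split_ord/=; congr (_ + _)%R; apply: eq_bigr => i _; rewrite addnC.
by rewrite addnC big_split_ord/= lerDl sumr_ge0.
Qed.

End sums.

Section average_run_length.
Context {dT dO} {T : measurableType dT} {Omega : measurableType dO} {R : realType}.
Variable X : nat -> {mfun Omega >-> T}.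
Variables (Pr : probability Omega R) (Q : probability T R).
Hypothesis XQ : independent_with_laws Pr X (fun=> Q).

(** The Shiryaev-Roberts statistic: the sum over all change-points [j <= k] of
    the likelihood ratio of [X j], ..., [X k]. *)
Fixpoint shiryaev_roberts (L : T -> R) (k : nat) (w : Omega) : R :=
  if k is k'.+1 then ((shiryaev_roberts L k' w + 1) * L (X k w))%R else 0%R.

Lemma shiryaev_roberts_ge0 L k w : (forall x, 0 <= L x)%R ->
  (0 <= shiryaev_roberts L k w)%R.
Proof.
by move=> L0; elim: k => //= k IH; rewrite mulr_ge0// addr_ge0.
Qed.

Lemma measurable_shiryaev_roberts L k : measurable_fun setT L ->
  measurable_fun (setT : set (filtered X k)) (shiryaev_roberts L k).
Proof.
move=> mL; elim: k => [|k IH] /=; first exact: measurable_cst.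
apply: measurable_funM.
  apply: measurable_funD; last exact: measurable_cst.
  exact: (filtered_measurable_fun_le (leqnSn k) IH).
by apply: filtered_observation => //; rewrite /= leqnn.
Qed.

(** Without change the statistic minus the time is a martingale, as [L] has
    mean 1 and [X k.+1] is independent of the past. *)
Lemma shiryaev_roberts_integralS (L : T -> R) k (C : set Omega) :
  measurable_fun setT L -> (forall x, 0 <= L x)%R ->
  \int[Q]_x (L x)%:E = 1 -> natural_filtration X k C ->
  \int[Pr]_(w in C) (shiryaev_roberts L k.+1 w)%:E =
  Pr C + \int[Pr]_(w in C) (shiryaev_roberts L k w)%:E.
Proof.
move=> mL L0 L1 FC.
have mC : measurable C by exact: natural_filtration_measurable FC.
have mSR := @measurable_shiryaev_roberts L k mL.
pose h := (fun w => (shiryaev_roberts L k w + 1)%:E) \_ C.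
transitivity (\int[Pr]_w (h w * (EFin \o L) (X k.+1 w))).
  rewrite integral_mkcond; apply: eq_integral => w _.
  rewrite /h !patchE; case: ifPn => _ /=; first by rewrite EFinM.
  exact/esym/mul0e.
rewrite (filtration_independent_integral XQ); first last.
- by move=> x; rewrite lee_fin.
- exact/measurable_EFinP.
- move=> w; rewrite /h patchE; case: ifPn => // _.
  by rewrite lee_fin addr_ge0// shiryaev_roberts_ge0.
- have mc : measurable (C : set (filtered X k)) by [].
  apply/(measurable_restrictT _ mc); apply: measurable_funTS.
  apply/measurable_EFinP; apply: measurable_funD => //.
rewrite [X in _ * X]L1 mule1 /h -integral_mkcond.
under eq_integral do rewrite EFinD.
rewrite ge0_integralD//; first last.
- apply/measurable_EFinP/measurable_funTS.
  exact: (filtered_measurable_fun mSR).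
- by move=> w _; rewrite lee_fin shiryaev_roberts_ge0.
by rewrite integral_cst// mul1e addeC.
Qed.

Variables (M : nat) (L : 'I_M -> T -> R).
Hypothesis mL : forall m, measurable_fun setT (L m).
Hypothesis L0 : forall m x, (0 <= L m x)%R.
Hypothesis L1 : forall m, \int[Q]_x (L m x)%:E = 1.
Variable tau : Omega -> \bar R.
Hypothesis tauP : stopping_time (natural_filtration X) tau.
Variable a : R.
Hypothesis a0 : (0 <= a)%R.
Hypothesis M0 : (0 < M)%N.
Hypothesis tau1 : reached tau 1 = setT.
Hypothesis tau_alarm : forall k w, (1 <= k)%N -> tau w = k%:R%:E ->
  (a <= \sum_(m < M) shiryaev_roberts (L m) k w)%R.

Let SR k w := (\sum_(m < M) shiryaev_roberts (L m) k w)%R.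
Let SR0 k w : (0 <= SR k w)%R.
Proof. by apply: sumr_ge0 => m _; exact: shiryaev_roberts_ge0. Qed.

Let mSR k : measurable_fun setT (EFin \o SR k).
Proof.
apply/measurable_EFinP; apply: measurable_sum => m.
exact: (filtered_measurable_fun (@measurable_shiryaev_roberts (L m) k (mL m))).
Qed.

Let SRS k (C : set Omega) : natural_filtration X k C ->
  \int[Pr]_(w in C) (SR k.+1 w)%:E =
  M%:R%:E * Pr C + \int[Pr]_(w in C) (SR k w)%:E.
Proof.
move=> FC; have mC : measurable C by exact: natural_filtration_measurable FC.
have E n : \int[Pr]_(w in C) (SR n w)%:E =
    \sum_(m < M) \int[Pr]_(w in C) (shiryaev_roberts (L m) n w)%:E.
  under eq_integral do rewrite /SR -sumEFin.
  rewrite ge0_integral_sum// => [m|m w _].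
    apply/measurable_EFinP/measurable_funTS.
    exact: (filtered_measurable_fun (@measurable_shiryaev_roberts (L m) n (mL m))).
  by rewrite lee_fin shiryaev_roberts_ge0.
rewrite !E; under eq_bigr do rewrite shiryaev_roberts_integralS//.
rewrite big_split/=; congr (_ + _).
by rewrite sumr_const card_ord mule_natl.
Qed.

(** Optional stopping for the sum of the [M] statistics: their value at the
    alarm is at least [a], and they grow by [M] in mean at each step.  The
    integral over the event that [tau] is still running makes the induction
    go through. *)
Let alarm_bound n :
  a%:E * Pr (~` reached tau n.+1) +
    \int[Pr]_(w in reached tau n.+1) (SR n w)%:E <=
  M%:R%:E * \sum_(0 <= k < n) Pr (reached tau k.+1).
Proof.
have mr := measurable_reached tauP.
elim: n => [|n IH].
  rewrite tau1 setCT measure0 mule0 add0e big_geq// mule0.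
  rewrite integral0_eq// => w _; rewrite /SR big1//.
rewrite big_nat_recr//= ge0_muleDr//; last first.
  by apply: sume_ge0 => k _; exact: measure_ge0.
apply: (@le_trans _ _ (a%:E * Pr (~` reached tau n.+1) +
    \int[Pr]_(w in reached tau n.+1) (SR n.+1 w)%:E)); last first.
  rewrite SRS; last exact: natural_filtration_reached.
  by rewrite addeCA addeC leeD2r.
pose E := reached tau n.+1 `\` reached tau n.+2.
have mE : measurable E by exact: measurableD.
have rE : reached tau n.+1 = E `|` reached tau n.+2.
  rewrite /E setUC setDUK//; exact: reached_le.
have CE : ~` reached tau n.+2 = ~` reached tau n.+1 `|` E.
  rewrite rE setCU; apply/seteqP; split=> w.
    by move=> nr; have [?|?] := pselect (E w); [right|left].
  by move=> [[]//|[]].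
rewrite CE measureU//; first last.
- by apply/seteqP; split=> w //= [] ? [].
- exact: measurableC.
rewrite [in X in _ <= _ + X]rE ge0_integral_setU//; first last.
- apply/disj_setPS => w [[? ?] ?] //.
- by move=> w _; rewrite lee_fin.
- exact: (measurable_funTS (mSR n.+1)).
rewrite ge0_muleDr// -addeA leeD2l// leeD2r//.
rewrite -integral_cst//; apply: ge0_le_integral => //.
- exact: (measurable_funTS (mSR n.+1)).
move=> w [rw nrw]; rewrite lee_fin; apply: tau_alarm => //.
case: (tauP.1 w) nrw rw => [tw []|[j tw]]; first by rewrite /reached /= tw leey.
rewrite /reached /= tw !lee_fin !ler_nat => /negP; rewrite -ltnNge ltnS => jn nj.
by congr (_%:R%:E); apply/eqP; rewrite eqn_leq jn.
Qed.

(** As [n] grows the bound above tends to the claim when the mean of [tau] is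
    finite, since then [tau] reaches [n] with probability of order [1 / n]. *)
Lemma average_run_length_ge : a%:E <= M%:R%:E * \int[Pr]_w tau w.
Proof.
rewrite (integral_stopping_time tauP).
set S := \sum_(k <oo) _.
have S0 : 0 <= S by apply: nneseries_ge0 => k _ _; exact: measure_ge0.
have partial n : \sum_(0 <= k < n) Pr (reached tau k.+1) <= S.
  by apply: nneseries_lim_ge => k _ _; exact: measure_ge0.
have [Soo|] := eqVneq S +oo.
  by rewrite Soo gt0_muley ?leey// lte_fin ltr0n.
rewrite -ltey -ge0_fin_numE// => Sfin; rewrite -(fineK Sfin) -EFinM lee_fin.
set s := fine S; have s0 : (0 <= s)%R by exact: fine_ge0.
pose p n := fine (Pr (reached tau n.+1)).
have pE n : Pr (reached tau n.+1) = (p n)%:E.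
  by rewrite fineK// fin_num_measure//; exact: (measurable_reached tauP).
have p0 n : (0 <= p n)%R by exact: fine_ge0.
have H1 n : (a * (1 - p n) <= M%:R * s)%R.
  rewrite -lee_fin EFinM EFinB -pE -probability_setC; last first.
    exact: (measurable_reached tauP).
  apply: (@le_trans _ _ (M%:R%:E * \sum_(0 <= k < n) Pr (reached tau k.+1))).
    apply: le_trans (alarm_bound n); rewrite leeDl// integral_ge0// => w _.
    by rewrite lee_fin.
  rewrite EFinM lee_wpmul2l// ?lee_fin// /s fineK//; exact: partial.
have H2 n : (n.+1%:R * p n <= s)%R.
  rewrite -lee_fin /s fineK//; apply: le_trans (partial n.+1).
  rewrite (eq_bigr (fun k => (p k)%:E)) => [|k _]; last exact: pE.
  rewrite sumEFin lee_fin big_mkord mulr_natl.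
  rewrite -[X in (_ *+ X)%R](card_ord n.+1) -sumr_const.
  apply: ler_sum => i _; rewrite -lee_fin -!pE le_measure ?inE//.
  - exact: (measurable_reached tauP).
  - exact: (measurable_reached tauP).
  - by apply: reached_le; rewrite ltnS -ltnS.
apply/ler_addgt0Pr => e e0.
have [n ne] : exists n : nat, (a * s / e < n.+1%:R)%R.
  exists (Num.truncn (a * s / e)).
  by exact: truncnS_gt.
have ane : (a * p n <= e)%R.
  have n0 : (0 < n.+1%:R :> R)%R by rewrite ltr0n.
  rewrite -(ler_pM2l n0); apply: (@le_trans _ _ (a * s)%R).
    by rewrite mulrCA ler_wpM2l.
  by rewrite -ler_pdivrMr// ltW.
by have := H1 n; lra.
Qed.

End average_run_length.

(** * Wald-type bounds for stopped log-likelihood ratios *)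

Section delay_bounds.
Context {dT dO} {T : measurableType dT} {Omega : measurableType dO} {R : realType}.
Variable X : nat -> {mfun Omega >-> T}.
Variable tau : Omega -> \bar R.
Hypothesis tauP : stopping_time (natural_filtration X) tau.

Lemma reached_observation (Pr : probability Omega R) (law : nat -> probability T R)
    (g : T -> R) (v : nat) (C : set Omega) :
  independent_with_laws Pr X law ->
  measurable_fun setT g -> (forall x, 0 <= g x)%R ->
  natural_filtration X v C ->
  \int[Pr]_w (\1_C w * g (X v.+1 w))%:E = Pr C * \int[law v.+1]_x (g x)%:E.
Proof.
move=> XPr mg g0 FC; under eq_integral do rewrite EFinM.
rewrite (filtration_independent_integral XPr (h := EFin \o \1_C) (g := EFin \o g)).
- by rewrite integral_indic ?setIT//; exact: natural_filtration_measurable FC.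
- have mc : measurable (C : set (filtered X v)) by [].
  apply/measurable_EFinP; exact: (@measurable_indic _ (filtered X v) R setT C mc).
- by move=> w; rewrite lee_fin.
- exact/measurable_EFinP.
- by move=> x; rewrite lee_fin.
Qed.

(** Wald's identity on the event [A] of the past: the mean of the sum of [l]
    until [tau] is the mean delay times the drift, which is at least [I],
    whereas the sum never exceeds [b + K].  Since [l] may be unbounded below,
    everything is phrased with the nonnegative function [K - l]. *)
Lemma delay_sum_le (Pr : probability Omega R) (law : nat -> probability T R)
    (P : probability T R) (l : T -> R) (K I b : R) (v : nat) :
  independent_with_laws Pr X law ->
  (forall k, (v < k)%N -> law k = P) ->
  measurable_fun setT l -> (forall x, l x <= K)%R ->
  \int[P]_x (K - l x)%:E <= (K - I)%:E -> (0 < I)%R -> (0 <= K)%R -> (0 <= b)%R ->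
  (forall n w, reached tau (v + n).+1 w ->
     \sum_(k < n.+1) l (X (v + k).+1 w) <= b + K)%R ->
  forall A, natural_filtration X v A ->
    \sum_(k <oo) Pr (reached tau (v.+1 + k) `&` A) <= ((b + K) / I)%:E * Pr A.
Proof.
move=> XPr lawP ml lK PI I0 K0 b0 over A FA.
have mA : measurable A by exact: natural_filtration_measurable FA.
pose C k := reached tau (v.+1 + k) `&` A.
have FC k : natural_filtration X (v + k) (C k).
  apply: (@measurableI _ (filtered X (v + k))).
    exact: (@natural_filtration_reached _ _ _ _ _ X tau tauP (v + k)).
  exact: (natural_filtration_le (leq_addr k v) FA).
have mC k : measurable (C k) by exact: natural_filtration_measurable (FC k).
have PA : Pr A \is a fin_num by exact: fin_num_measure.
pose p k := fine (Pr (C k)).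
have pE k : Pr (C k) = (p k)%:E by rewrite fineK// fin_num_measure.
have p0 k : (0 <= p k)%R by exact: fine_ge0.
apply: lime_le.
  by apply: is_cvg_nneseries => k _ _; exact: measure_ge0.
apply: nearW => n.
rewrite (eq_bigr (fun k => (p k)%:E)) => [|k _]; last exact: pE.
rewrite big_mkord sumEFin -(fineK PA) -EFinM lee_fin mulrAC ler_pdivlMr//.
set S := (\sum_(k < n) p k)%R.
have pointwise w : (\sum_(k < n) K * \1_(C k) w <=
    \sum_(k < n) \1_(C k) w * (K - l (X (v + k).+1 w)) + (b + K) * \1_A w)%R.
  rewrite -lerBlDl -sumrB.
  under eq_bigr do rewrite mulrBr [(K * _)%R]mulrC opprB addrC subrK.
  have [Aw|Aw] := pselect (A w); last first.
    rewrite !indicE (memNset Aw) mulr0 big1// => k _.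
    by rewrite indicE memNset ?mul0r// => -[].
  rewrite indicE mem_set// mulr1.
  elim: n {S} => [|n IH]; first by rewrite big_ord0 addr_ge0.
  have [rn|rn] := pselect (reached tau (v + n).+1 w); last first.
    rewrite big_ord_recr/= [X in (_ + X * _)%R]indicE memNset ?mul0r ?addr0//.
    by move=> [].
  apply: le_trans (over n w rn); apply: ler_sum => i _.
  rewrite indicE mem_set ?mul1r//; split => //.
  by apply: reached_le rn; rewrite addSn ltnS leq_add2l -ltnS.
have mobs k : measurable_fun setT (fun w => (\1_(C k) w * (K - l (X (v + k).+1 w)))%:E).
  apply/measurable_EFinP; apply: measurable_funM; first exact: measurable_indic.
  apply: measurable_funB => //; apply: (measurableT_comp ml).
  exact: measurable_funPT.
have obs0 k w : (0 <= \1_(C k) w * (K - l (X (v + k).+1 w)))%R.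
  by rewrite mulr_ge0// subr_ge0.
have : (K * S)%:E <= ((K - I) * S + (b + K) * fine (Pr A))%:E.
  have -> : (K * S)%:E = \int[Pr]_w (\sum_(k < n) (K * \1_(C k) w)%:E).
    rewrite ge0_integral_sum// => [|k|k w _].
    - rewrite /S mulr_sumr -sumEFin; apply: eq_bigr => k _.
      under eq_integral do rewrite EFinM.
      rewrite ge0_integralZl//; last by apply/measurable_EFinP.
      by rewrite integral_indic// setIT EFinM; congr (_ * _); exact: esym (pE k).
    - by apply/measurable_EFinP; apply: measurable_funM.
    - by rewrite lee_fin mulr_ge0.
  apply: (@le_trans _ _ (\int[Pr]_w (\sum_(k < n)
      (\1_(C k) w * (K - l (X (v + k).+1 w)))%:E + ((b + K) * \1_A w)%:E))).
    apply: ge0_le_integral => //.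
    - by move=> w _; apply: sume_ge0 => k _; rewrite lee_fin mulr_ge0.
    - apply: emeasurable_sum => k; apply/measurable_EFinP.
      exact: measurable_funM.
    - apply: emeasurable_funD; first exact: emeasurable_sum.
      by apply/measurable_EFinP; exact: measurable_funM.
    - by move=> w _; rewrite !sumEFin -EFinD lee_fin.
  have bK0 : (0 <= b + K)%R by exact: addr_ge0.
  rewrite ge0_integralD//; first last.
  - by apply/measurable_EFinP; exact: measurable_funM.
  - by move=> w _; rewrite lee_fin mulr_ge0.
  - exact: emeasurable_sum.
  - by move=> w _; apply: sume_ge0 => k _; rewrite lee_fin.
  rewrite EFinD; apply: leeD; last first.
    under eq_integral do rewrite EFinM.
    rewrite ge0_integralZl//; last by apply/measurable_EFinP.
    by rewrite integral_indic// setIT EFinM fineK.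
  rewrite ge0_integral_sum//; last by move=> k w _; rewrite lee_fin.
  rewrite /S mulr_sumr -sumEFin; apply: lee_sum => k _.
  rewrite (@reached_observation Pr law (fun x => K - l x)%R)//; last 2 first.
  - exact: measurable_funB.
  - by move=> x; rewrite subr_ge0.
  rewrite lawP ?ltnS ?leq_addr// pE muleC EFinM lee_wpmul2r// lee_fin//.
by rewrite lee_fin mulrBl; lra.
Qed.

(** Integrating [stopped_tangent] under a change at time [v.+1].  The change of
    measure turns the exponentials of the stopped log-likelihood ratio into
    probabilities without change, and Wald's identity turns its mean into
    [I] times the mean delay, truncated to [m] steps. *)
Lemma stopped_information_le (Pinf Pnu : probability Omega R)
    (Q P : probability T R) (l : T -> R) (K I y : R) (v m : nat) :
  independent_with_laws Pinf X (fun=> Q) ->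
  independent_with_laws Pnu X (fun k => if (k <= v)%N then Q else P) ->
  measurable_fun setT l -> (forall x, l x <= K)%R ->
  (K - I)%:E <= \int[P]_x (K - l x)%:E -> (0 <= K)%R -> (0 <= y)%R ->
  (forall A, measurable A -> Q A = \int[P]_(x in A) (expR (- l x))%:E) ->
  (fine (Pnu (reached tau v.+1)) +
     y * \sum_(i < m) fine (Pnu (reached tau (v + i).+1 `\` reached tau (v + i).+2)) <=
   expR y * \sum_(i < m) fine (Pinf (reached tau (v + i).+1 `\` reached tau (v + i).+2))
   + fine (Pinf (reached tau (v + m).+1))
   + I * \sum_(i < m) fine (Pnu (reached tau (v + i).+1)))%R.
Proof.
move=> XQ XP ml lK PI K0 y0 QP.
pose U i := reached tau (v + i).+1.
pose C i := U i `\` U i.+1.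
have FU i : natural_filtration X (v + i) (U i).
  exact: (@natural_filtration_reached _ _ _ _ _ X tau tauP (v + i)).
have mU i : measurable (U i) by exact: (measurable_reached tauP).
have FC i : natural_filtration X (v + i).+1 (C i).
  apply: (@measurableD _ (filtered X (v + i).+1)).
    exact: (natural_filtration_le (leqnSn (v + i)) (FU i)).
  by rewrite -addnS; exact: FU.
have mC i : measurable (C i) by exact: measurableD.
(* The density of no change with respect to a change at time [v.+1]. *)
pose W k x := if (k <= v)%N then 1%R else expR (- l x).
have mW k : measurable_fun setT (W k).
  rewrite /W; case: (k <= v)%N; first exact: measurable_cst.
  apply: (measurableT_comp (@measurable_expR R)).
  exact: measurableT_comp.
have W0 k x : (0 <= W k x)%R by rewrite /W; case: ifP => _ //; exact: expR_ge0.
have lawW k A : (1 <= k)%N -> measurable A ->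
    Q A = \int[if (k <= v)%N then Q else P]_(x in A) (W k x)%:E.
  move=> _ mA; rewrite /W; case: (k <= v)%N; last exact: QP.
  by rewrite integral_cst// mul1e.
have likE i w : likelihood X W (v + i) w =
    expR (- \sum_(j < i) l (X (v + j).+1 w))%R.
  rewrite /likelihood; elim: i => [|i IH].
    rewrite addn0 big_ord0 oppr0 expR0 big_nat_cond big1// => k.
    by rewrite andbT ltnS => /andP[_ kv]; rewrite /W kv.
  rewrite addnS big_nat_recr//= IH big_ord_recr/= opprD expRD.
  by rewrite /W ltnNge leq_addr.
have cm n A : natural_filtration X n A ->
    \int[Pnu]_w (\1_A w * likelihood X W n w)%:E = Pinf A.
  move=> FA; rewrite (change_of_measure XQ XP mW W0 lawW FA).
  rewrite [RHS]integral_mkcond; apply: eq_integral => w _.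
  by rewrite patchE indicE; case: ifPn => _; rewrite ?mul1r// mul0r.
have mlik n : measurable_fun setT (likelihood X W n).
  exact: (filtered_measurable_fun (@measurable_likelihood _ _ _ _ _ X W mW n)).
have lik0 n w : (0 <= likelihood X W n w)%R by exact: likelihood_ge0.
pose p i := fine (Pnu (U i)); pose c i := fine (Pnu (C i)).
pose c' i := fine (Pinf (C i)); pose p' i := fine (Pinf (U i)).
have pE i : Pnu (U i) = (p i)%:E by rewrite fineK// fin_num_measure.
have cE i : Pnu (C i) = (c i)%:E by rewrite fineK// fin_num_measure.
have p'E i : Pinf (U i) = (p' i)%:E by rewrite fineK// fin_num_measure.
have c'E i : Pinf (C i) = (c' i)%:E by rewrite fineK// fin_num_measure.
have [p0 c0] : (forall i, 0 <= p i)%R /\ (forall i, 0 <= c i)%R.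
  by split=> i; exact: fine_ge0.
suff : (p 0%N + y * \sum_(i < m) c i + (K - I) * \sum_(i < m) p i <=
   expR y * \sum_(i < m) c' i + p' m + K * \sum_(i < m) p i)%R.
  by rewrite /p /c /c' /p' /C /U addn0; under [X in (y * X)%R]eq_bigr do rewrite addnS;
     under [X in (expR y * X)%R]eq_bigr do rewrite addnS; lra.
pose obs i w := (K - l (X (v + i).+1 w))%R.
have mobs i : measurable_fun setT (obs i).
  apply: measurable_funB => //; apply: (measurableT_comp ml).
  exact: measurable_funPT.
have obs0 i w : (0 <= obs i w)%R by rewrite subr_ge0.
pose lhs w := (\1_(U 0) w + y * \sum_(i < m) \1_(C i) w +
  \sum_(i < m) \1_(U i) w * obs i w)%R.
pose rhs w := (expR y * \sum_(i < m) \1_(C i) w * likelihood X W (v + i).+1 w +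
  \1_(U m) w * likelihood X W (v + m) w + K * \sum_(i < m) \1_(U i) w)%R.
have pointwise w : (lhs w <= rhs w)%R.
  have := @stopped_tangent R (fun i => w \in U i)
    (fun i => l (X (v + i).+1 w)) y m.
  have -> : (\sum_(i < m) (w \in U i)%:R * l (X (v + i).+1 w) =
      K * \sum_(i < m) \1_(U i) w - \sum_(i < m) \1_(U i) w * obs i w)%R.
    rewrite mulr_sumr -sumrB; apply: eq_bigr => i _.
    by rewrite indicE /obs; ring.
  have CU i : (w \in U i) && (w \notin U i.+1) = (w \in C i).
    by apply/andP/idP => [[/set_mem ? /negP nU]|/set_mem[? nU]];
      [apply/mem_set; split => // ?; apply: nU; exact/mem_set
      |split; [exact/mem_set|by apply/negP => /set_mem]].
  under eq_bigr do rewrite CU.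
  under [X in (_ <= expR y * X + _ + _)%R]eq_bigr => i _ do
    rewrite CU -(likE i.+1 w) addnS.
  rewrite -(likE m w) /lhs /rhs => tangent.
  rewrite -lerBrDr -addrA indicE [X in (y * X)%R](_ : _ =
    (\sum_(i < m) (w \in C i)%:R)%R); last by apply: eq_bigr => i _; rewrite indicE.
  apply: le_trans (tangent _) _.
    move=> i /set_mem Ui; apply/mem_set; apply: reached_le Ui.
    by rewrite addnS ltnS.
  by rewrite !indicE !addrA.
have m1 i : measurable_fun setT (\1_(U i) : Omega -> R) by exact: measurable_indic.
have mC1 i : measurable_fun setT (\1_(C i) : Omega -> R) by exact: measurable_indic.
have int1 (A : set Omega) : measurable A ->
    \int[Pnu]_w (\1_A w)%:E = Pnu A.
  by move=> mA; rewrite integral_indic// setIT.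
have sumE (f : nat -> Omega -> R) : (forall i, measurable_fun setT (f i)) ->
    (forall i w, 0 <= f i w)%R ->
    \int[Pnu]_w (\sum_(i < m) f i w)%:E = \sum_(i < m) \int[Pnu]_w (f i w)%:E.
  move=> mf f0; under eq_integral do rewrite -sumEFin.
  rewrite ge0_integral_sum// => i; [exact/measurable_EFinP|].
  by move=> w _; rewrite lee_fin.
have scaleE (a : R) (f : Omega -> R) : measurable_fun setT f ->
    (forall w, 0 <= f w)%R -> (0 <= a)%R ->
    \int[Pnu]_w (a * f w)%:E = a%:E * \int[Pnu]_w (f w)%:E.
  move=> mf f0 a0; under eq_integral do rewrite EFinM.
  by rewrite ge0_integralZl// => [|w _]; [exact/measurable_EFinP|rewrite lee_fin].
have addE (f g : Omega -> R) : measurable_fun setT f -> measurable_fun setT g ->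
    (forall w, 0 <= f w)%R -> (forall w, 0 <= g w)%R ->
    \int[Pnu]_w (f w + g w)%:E = \int[Pnu]_w (f w)%:E + \int[Pnu]_w (g w)%:E.
  move=> mf mg f0 g0; under eq_integral do rewrite EFinD.
  by rewrite ge0_integralD// => [w _||w _|];
    [rewrite lee_fin|exact/measurable_EFinP|rewrite lee_fin|exact/measurable_EFinP].
have sum0 (f : nat -> Omega -> R) : (forall i w, 0 <= f i w)%R ->
    forall w, (0 <= \sum_(i < m) f i w)%R.
  by move=> f0 w; apply: sumr_ge0.
have msum (f : nat -> Omega -> R) : (forall i, measurable_fun setT (f i)) ->
    measurable_fun setT (fun w => \sum_(i < m) f i w)%R.
  by move=> mf; exact: measurable_sum.
have mUo i : measurable_fun setT (fun w => \1_(U i) w * obs i w)%R.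
  exact: measurable_funM.
have mCl i : measurable_fun setT
    (fun w => \1_(C i) w * likelihood X W (v + i).+1 w)%R.
  exact: measurable_funM.
have lhsE : (p 0%N + y * \sum_(i < m) c i + (K - I) * \sum_(i < m) p i)%:E <=
    \int[Pnu]_w (lhs w)%:E.
  rewrite /lhs !addE ?scaleE ?int1//.
  - rewrite (sumE (fun i w => \1_(C i) w))//.
    rewrite (sumE (fun i w => \1_(U i) w * obs i w)%R)//; last first.
      by move=> i w; rewrite mulr_ge0.
    rewrite !EFinD; apply: leeD; first apply: leeD.
    + by rewrite -pE.
    + rewrite EFinM lee_wpmul2l ?lee_fin// -sumEFin.
      by apply: lee_sum => i _; rewrite int1// cE.
    rewrite mulr_sumr -sumEFin; apply: lee_sum => i _.
    rewrite (@reached_observation Pnu _ (fun x => K - l x)%R _ _ XP)//.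
    + rewrite ltnNge leq_addr/= -/(U i) pE muleC EFinM.
      by rewrite lee_wpmul2r// lee_fin.
    + exact: measurable_funB.
    + by move=> x; rewrite subr_ge0.
  - exact: (msum (fun i w => \1_(C i) w)).
  - exact: (sum0 (fun i w => \1_(C i) w)).
  - by apply: measurable_funM => //; exact: (msum (fun i w => \1_(C i) w)).
  - by move=> w; rewrite mulr_ge0// (sum0 (fun i w => \1_(C i) w)).
  - apply: measurable_funD => //.
    by apply: measurable_funM => //; exact: (msum (fun i w => \1_(C i) w)).
  - exact: (msum (fun i w => \1_(U i) w * obs i w)%R).
  - by move=> w; rewrite addr_ge0// mulr_ge0// (sum0 (fun i w => \1_(C i) w)).
  - by apply: (sum0 (fun i w => \1_(U i) w * obs i w)%R) => i w; rewrite mulr_ge0.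
have rhsE : \int[Pnu]_w (rhs w)%:E <=
    (expR y * \sum_(i < m) c' i + p' m + K * \sum_(i < m) p i)%:E.
  have ey0 : (0 <= expR y)%R by exact: expR_ge0.
  have Cl0 i w : (0 <= \1_(C i) w * likelihood X W (v + i).+1 w)%R.
    by rewrite mulr_ge0.
  have sumCl0 := sum0 (fun i w => \1_(C i) w * likelihood X W (v + i).+1 w)%R Cl0.
  have msumCl := msum (fun i w => \1_(C i) w * likelihood X W (v + i).+1 w)%R mCl.
  have sumU0 := sum0 (fun i w => \1_(U i) w) (fun i w => ler0n _ _).
  have msumU := msum (fun i w => \1_(U i) w) m1.
  have mUl : measurable_fun setT (fun w => \1_(U m) w * likelihood X W (v + m) w)%R.
    exact: measurable_funM.
  have Ul0 w : (0 <= \1_(U m) w * likelihood X W (v + m) w)%R by rewrite mulr_ge0.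
  rewrite /rhs !addE ?scaleE ?int1//.
  - rewrite (sumE (fun i w => \1_(C i) w * likelihood X W (v + i).+1 w)%R)//.
    rewrite (sumE (fun i w => \1_(U i) w))// cm// p'E.
    rewrite !EFinD; apply: leeD; first apply: leeD => //.
    + rewrite EFinM lee_wpmul2l// -?sumEFin ?lee_fin//.
      by apply: lee_sum => i _; rewrite cm// c'E.
    + rewrite EFinM lee_wpmul2l ?lee_fin// -sumEFin.
      by apply: lee_sum => i _; rewrite int1// pE.
  - exact: measurable_funM.
  - by move=> w; rewrite mulr_ge0.
  - by apply: measurable_funD => //; exact: measurable_funM.
  - exact: measurable_funM.
  - by move=> w; rewrite addr_ge0// mulr_ge0.
  - by move=> w; rewrite mulr_ge0.
rewrite -lee_fin; apply: le_trans lhsE (le_trans _ rhsE).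
apply: ge0_le_integral => //.
- move=> w _; rewrite lee_fin /lhs addr_ge0 ?addr_ge0 ?mulr_ge0 ?sumr_ge0// => i _.
  by rewrite mulr_ge0.
- apply/measurable_EFinP; apply: measurable_funD.
    apply: measurable_funD => //; apply: measurable_funM => //.
    exact: (msum (fun i w => \1_(C i) w)).
  exact: (msum (fun i w => \1_(U i) w * obs i w)%R).
- apply/measurable_EFinP; apply: measurable_funD.
    apply: measurable_funD; apply: measurable_funM => //.
    exact: (msum (fun i w => \1_(C i) w * likelihood X W (v + i).+1 w)%R).
  by apply: measurable_funM => //; exact: (msum (fun i w => \1_(U i) w)).
- by move=> w _; rewrite lee_fin.
Qed.

End delay_bounds.

(** * The information lower bound on the delay *)

Section lower_bound.
Context {dT dO} {T : measurableType dT} {Omega : measurableType dO} {R : realType}.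
Variable X : nat -> {mfun Omega >-> T}.
Variable tau : Omega -> \bar R.
Hypothesis tauP : stopping_time (natural_filtration X) tau.

Lemma fine_probability_setD (Pr : probability Omega R) (A B : set Omega) :
  measurable A -> measurable B -> B `<=` A ->
  fine (Pr (A `\` B)) = (fine (Pr A) - fine (Pr B))%R.
Proof.
move=> mA mB BA; have PA : Pr A \is a fin_num by exact: fin_num_measure.
rewrite measureD//; last by rewrite -ge0_fin_numE.
rewrite setIidr// fineB//; exact: fin_num_measure.
Qed.

Lemma fine_probability_le (Pr : probability Omega R) (A B : set Omega) :
  measurable A -> measurable B -> A `<=` B -> (fine (Pr A) <= fine (Pr B))%R.
Proof.
move=> mA mB AB; apply: fine_le; [exact: fin_num_measure..|].
by apply: le_measure; rewrite ?inE.
Qed.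

(** A pigeonhole argument: if every window of length [m] had conditional
    stopping probability above [2 * m / g], then summing over the starting
    points, where the stopping probabilities telescope to at most [m], would
    bound the mean of [tau] by [g / 2]. *)
Lemma quiet_window (Pr : probability Omega R) (g : R) (m : nat) :
  (0 < g)%R -> (0 < m)%N -> g%:E <= \int[Pr]_w tau w ->
  exists v, let p k := fine (Pr (reached tau k.+1)) in
    (0 < p v)%R /\ (p v - p (v + m)%N <= 2 * m%:R / g * p v)%R.
Proof.
move=> g0 m0 gtau; pose p k := fine (Pr (reached tau k.+1)).
have mr k : measurable (reached tau k) by exact: (measurable_reached tauP).
have pE k : Pr (reached tau k.+1) = (p k)%:E by rewrite fineK// fin_num_measure.
have p0 k : (0 <= p k)%R by exact: fine_ge0.
have p1 k : (p k <= 1)%R.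
  by rewrite -lee_fin -pE; exact: probability_le1.
apply/not_existsP => nov.
have gap v : (2 * m%:R / g * p v <= p v - p (v + m)%N)%R.
  have [pv|pv] := eqVneq (p v) 0%R.
    rewrite {1}pv mulr0 subr_ge0; apply: fine_probability_le => //.
    by apply: reached_le; rewrite ltnS leq_addr.
  rewrite leNgt; apply/negP => /ltW h; apply: (nov v); split => //.
  by rewrite lt_neqAle eq_sym pv p0.
have S2 N : (\sum_(k < N) p k <= g / 2)%R.
  have m0' : (0 < m%:R :> R)%R by rewrite ltr0n.
  have : (2 * m%:R / g * \sum_(k < N) p k <= m%:R)%R.
    rewrite mulr_sumr; apply: (@le_trans _ _ (\sum_(k < N) (p k - p (k + m)%N))%R).
      by apply: ler_sum => i _; exact: gap.
    apply: le_trans (sum_shift_le m N p0) _.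
    apply: (@le_trans _ _ (\sum_(k < m) 1)%R); first exact: ler_sum.
    by rewrite sumr_const card_ord.
  rewrite -(ler_pM2l m0') => h.
  have c0 : (0 < 2 * m%:R / g)%R by rewrite divr_gt0// mulr_gt0.
  rewrite -(ler_pM2l c0); apply: le_trans (_ : (_ <= m%:R)%R) _.
    by rewrite -(ler_pM2l m0').
  by rewrite le_eqVlt; apply/orP; left; apply/eqP; field; rewrite gt_eqF.
have : \int[Pr]_w tau w <= (g / 2)%:E.
  rewrite (integral_stopping_time tauP); apply: lime_le.
    by apply: is_cvg_nneseries => k _ _; exact: measure_ge0.
  apply: nearW => N; rewrite (eq_bigr (fun k => (p k)%:E)) => [|k _]; last exact: pE.
  by rewrite big_mkord sumEFin lee_fin.
by move=> /(le_trans gtau); rewrite lee_fin; lra.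
Qed.

(** The tangent of [stopped_information_le] is taken at [y = ln (g / (2 * m))],
    for which [exp y] compensates the stopping probability [2 * m / g] of a
    quiet window; Markov's inequality bounds by [D / m] the probability that
    [tau] runs through the window after a change. *)
Lemma WADD_information_bound (Pinf : probability Omega R)
    (Pnu : nat -> probability Omega R)
    (Q P : probability T R) (l : T -> R) (K I D g : R) (m : nat) :
  independent_with_laws Pinf X (fun=> Q) ->
  (forall nu, (1 <= nu)%N ->
    independent_with_laws (Pnu nu) X (fun k => if (k < nu)%N then Q else P)) ->
  measurable_fun setT l -> (forall x, l x <= K)%R ->
  (K - I)%:E <= \int[P]_x (K - l x)%:E -> (0 <= K)%R -> (0 <= I)%R ->
  (forall A, measurable A -> Q A = \int[P]_(x in A) (expR (- l x))%:E) ->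
  (0 < m)%N -> (2 * m%:R <= g)%R -> g%:E <= \int[Pinf]_w tau w ->
  (0 <= D)%R -> WADD X Pnu tau <= D%:E ->
  (ln (g / (2 * m%:R)) - 1 <= D * (I + ln (g / (2 * m%:R)) / m%:R))%R.
Proof.
move=> XQ XP ml lK PI K0 I0 QP m0 mg gtau D0 WD.
have m0' : (0 < 2 * m%:R :> R)%R by rewrite mulr_gt0 ?ltr0n.
have g0 : (0 < g)%R by exact: lt_le_trans mg.
have [v [pv0 window]] := quiet_window g0 m0 gtau.
have FU i : natural_filtration X (v + i) (reached tau (v + i).+1).
  exact: (@natural_filtration_reached _ _ _ _ _ X tau tauP (v + i)).
have mU i : measurable (reached tau i) by exact: (measurable_reached tauP).
pose p' i := fine (Pinf (reached tau (v + i).+1)).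
pose p i := fine (Pnu v.+1 (reached tau (v + i).+1)).
have pE i : Pnu v.+1 (reached tau (v + i).+1) = (p i)%:E.
  by rewrite fineK// fin_num_measure.
have pre : p 0%N = p' 0%N.
  rewrite /p /p'; congr fine; apply: (cylinder_measure_unique _ _ (FU 0%N)).
    by rewrite (le_lt_trans (probability_le1 _ _))// ltry.
  rewrite addn0 => A mA.
  apply: (etrans (probability_cylinder (XP v.+1 isT) v mA)).
  apply: (etrans _ (esym (probability_cylinder XQ v mA))).
  rewrite big_nat_cond [RHS]big_nat_cond.
  by apply: eq_bigr => k; rewrite andbT => /andP[_ ->].
have decr i : reached tau (v + i).+2 `<=` reached tau (v + i).+1.
  exact: reached_le.
have tele (Pr : probability Omega R) :
    (\sum_(i < m) fine (Pr (reached tau (v + i).+1 `\` reached tau (v + i).+2)) =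
     fine (Pr (reached tau v.+1)) - fine (Pr (reached tau (v + m).+1)))%R.
  elim: (m) => [|j IH]; first by rewrite big_ord0 addn0 subrr.
  rewrite big_ord_recr/= IH fine_probability_setD// addnS.
  by rewrite addrA subrK.
have XP' : independent_with_laws (Pnu v.+1) X
    (fun k => if (k <= v)%N then Q else P) by exact: XP.
set y := ln (g / (2 * m%:R)).
have y0 : (0 <= y)%R by apply: ln_ge0; rewrite ler_pdivlMr// mul1r.
have := stopped_information_le tauP m XQ XP' ml lK PI K0 y0 QP.
rewrite !tele -[v in fine (Pnu _ (reached tau v.+1))]addn0.
rewrite -[v in fine (Pinf (reached tau v.+1))]addn0.
rewrite -/(p 0%N) -/(p' 0%N) -/(p m) -/(p' m) pre => info.
rewrite /= -[v in reached tau v.+1]addn0 -/(p' 0%N) in pv0.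
rewrite /= -/(p' m) -[v in fine (Pinf (reached tau v.+1))]addn0 -/(p' 0%N) in window.
have ey : expR y = (g / (2 * m%:R))%R by rewrite lnK// posrE divr_gt0.
have window' : (expR y * (p' 0%N - p' m) <= p' 0%N)%R.
  rewrite ey mulrC -ler_pdivlMr ?divr_gt0//.
  by rewrite invf_div mulrC.
have pm' : (p' m <= p' 0%N)%R.
  apply: fine_probability_le => //.
  by apply: reached_le; rewrite addn0 ltnS leq_addr.
have delay : (\sum_(i < m) p i <= D * p' 0%N)%R.
  have FU0 : natural_filtration X v.+1.-1 (reached tau (v + 0).+1).
    by have := FU 0%N; rewrite addn0.
  have := (WADD_leP tauP Pnu D0).1 WD v.+1 _ isT FU0.
  rewrite pE pre -EFinM -lee_fin => H; rewrite -sumEFin.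
  apply: le_trans H.
  apply: (le_trans _ (nneseries_lim_ge m _)) => [|k _ _]; last exact: measure_ge0.
  rewrite big_mkord; apply: lee_sum => i _; rewrite -pE setIidl ?addSn//.
  by apply: reached_le; rewrite addn0 ltnS leq_addr.
have pmm : (m%:R * p m <= \sum_(i < m) p i)%R.
  rewrite mulr_natl -[X in (_ *+ X)%R](card_ord m) -sumr_const.
  apply: ler_sum => i _; apply: fine_probability_le => //.
  by apply: reached_le; rewrite ltnS leq_add2l ltnW.
have mR : (0 < m%:R :> R)%R by rewrite ltr0n.
have pmD : (p m <= D / m%:R * p' 0%N)%R.
  by rewrite mulrAC ler_pdivlMr// mulrC; exact: le_trans delay.
have ID : (I * \sum_(i < m) p i <= I * (D * p' 0%N))%R by rewrite ler_wpM2l.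
have yp : (y * p m <= y * (D / m%:R * p' 0%N))%R by rewrite ler_wpM2l.
rewrite -(ler_pM2r pv0).
have -> : (D * (I + y / m%:R) * p' 0%N =
  I * (D * p' 0%N) + y * (D / m%:R * p' 0%N))%R by ring.
have {}info : (p' 0%N + y * (p' 0%N - p m) <=
  expR y * (p' 0%N - p' m) + p' m + I * \sum_(i < m) p i)%R by exact: info.
move: info; rewrite mulrBr; lra.
Qed.

End lower_bound.

(** * The DR-CuSum test *)

Section dr_cusum.
Context {dT dO} {T : measurableType dT} {Omega : measurableType dO} {R : realType}.
Variable X : nat -> {mfun Omega >-> T}.

(** Observations stay in the sample space [D], so that the log-likelihood
    ratios may be extended by 0 to measurable functions on the whole space. *)
Lemma eq_tau_DR (D : set T) (M : nat) (l l' : 'I_M -> T -> R) (b : R) :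
  (forall k w, (1 <= k)%N -> D (X k w)) -> (forall m x, D x -> l m x = l' m x) ->
  tau_DR X l b = tau_DR X l' b.
Proof.
move=> XD ll'; have E m k w : cusum X (l m) k w = cusum X (l' m) k w.
  by elim: k => //= k ->; rewrite ll'//; exact: XD.
have Emax k w : \big[maxe/-oo]_(m < M) (cusum X (l m) k w)%:E =
    \big[maxe/-oo]_(m < M) (cusum X (l' m) k w)%:E.
  by apply: eq_bigr => m _; rewrite E.
apply/funext => w; rewrite /tau_DR; congr (ereal_inf (image _ _)).
by apply/seteqP; split=> k /= [k1]; rewrite Emax.
Qed.

Variables (M : nat) (l : 'I_M -> T -> R) (b : R).
Hypothesis ml : forall m, measurable_fun setT (l m).

Let alarm k w := exists m, (b <= cusum X (l m) k w)%R.
Let tau := tau_DR X l b.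

Lemma alarmP k w :
  b%:E <= \big[maxe/-oo]_(m < M) (cusum X (l m) k w)%:E <-> alarm k w.
Proof.
split=> [|[m bm]].
  elim/big_ind : _ => [|x y IHx IHy|m _]; first by rewrite leeNy_eq.
    by rewrite le_max => /orP[/IHx|/IHy].
  by rewrite lee_fin => bm; exists m.
apply: (@le_trans _ _ (cusum X (l m) k w)%:E); first by rewrite lee_fin.
by rewrite (bigD1 m)//= le_max lexx.
Qed.

Lemma tau_DR_le k w : (1 <= k)%N -> alarm k w -> tau w <= k%:R%:E.
Proof.
by move=> k1 ak; apply: ereal_inf_lbound; exists k => //; split => //; exact/alarmP.
Qed.

Lemma tau_DR_cases w : tau w = +oo \/
  exists k : nat, [/\ (1 <= k)%N, alarm k w & tau w = k%:R%:E].
Proof.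
have [[k0 [k01 ak0]]|no] := pselect (exists k, (1 <= k)%N /\ alarm k w); last first.
  left; rewrite /tau /tau_DR [X in ereal_inf X](_ : _ = set0) ?ereal_inf0//.
  apply/seteqP; split=> // x [k [k1 /alarmP ak] _].
  by case: no; exists k.
have ex : exists k, (1 <= k)%N && `[< alarm k w >].
  by exists k0; rewrite k01/=; exact/asboolP.
right; case: (ex_minnP ex) => k /andP[k1 /asboolP ak] kmin.
exists k; split => //; apply/eqP; rewrite eq_le tau_DR_le//=.
apply: le_ereal_inf_tmp => _ [j [j1 /alarmP aj] <-].
by rewrite lee_fin ler_nat; apply: kmin; rewrite j1/=; exact/asboolP.
Qed.

Lemma measurable_cusum m k :
  measurable_fun (setT : set (filtered X k)) (cusum X (l m) k).
Proof.
elim: k => [|k IH] /=; first exact: measurable_cst.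
apply: measurable_funD.
  apply: measurable_maxr; last exact: measurable_cst.
  exact: (filtered_measurable_fun_le (leqnSn k) IH).
by apply: filtered_observation => //; rewrite /= leqnn.
Qed.

Lemma stopping_time_tau_DR : stopping_time (natural_filtration X) tau.
Proof.
split=> [w|k].
  by case: (tau_DR_cases w) => [|[k [_ _]]]; [left|right; exists k].
have -> : [set w | tau w <= k%:R%:E] =
    \bigcup_(j in [set j | (1 <= j <= k)%N]) \bigcup_(m in [set: 'I_M])
      (cusum X (l m) j @^-1` `[b, +oo[%classic).
  apply/seteqP; split=> w.
    rewrite /=; case: (tau_DR_cases w) => [->//|[j [j1 [m bm] ->]]].
    rewrite lee_fin ler_nat => jk; exists j; first by rewrite /= j1.
    by exists m => //=; rewrite in_itv/= bm.
  move=> [j /= /andP[j1 jk] [m _ /=]]; rewrite in_itv/= andbT => bm.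
  apply: (@le_trans _ _ j%:R%:E); last by rewrite lee_fin ler_nat.
  by apply: tau_DR_le => //; exists m.
apply: (@fin_bigcup_measurable _ (filtered X k)).
  by apply: (@sub_finite_set _ _ `I_k.+1) => // j /= /andP[_]; rewrite ltnS.
move=> j /= /andP[j1 jk].
apply: (@fin_bigcup_measurable _ (filtered X k)) => // m _.
apply: (natural_filtration_le jk).
rewrite -[X in natural_filtration _ _ X]setTI.
by apply: (@measurable_cusum m j) => //.
Qed.

Lemma reached_tau_DR1 : reached tau 1 = setT.
Proof.
apply/seteqP; split=> // w _; rewrite /reached /=.
by case: (tau_DR_cases w) => [->|[k [k1 _ ->]]]; rewrite ?leey// lee_fin ler_nat.
Qed.

Lemma cusum_ge_sum m v n w :
  (\sum_(k < n.+1) l m (X (v + k).+1 w) <= cusum X (l m) (v + n).+1 w)%R.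
Proof.
elim: n => [|n IH].
  by rewrite big_ord1 /= addn0 lerDr le_max lexx orbT.
by rewrite big_ord_recr/= addnS lerD2r le_max IH.
Qed.

(** Before the alarm the CuSum, hence the sum of [l m] since [v], is below [b],
    and the last increment is at most [K]. *)
Lemma overshoot (K : R) m v n w : (0 <= b)%R -> (forall x, l m x <= K)%R ->
  reached tau (v + n).+1 w ->
  (\sum_(k < n.+1) l m (X (v + k).+1 w) <= b + K)%R.
Proof.
move=> b0 lK; rewrite big_ord_recr/=; case: n => [|n] r.
  by rewrite big_ord0 lerD.
rewrite lerD//; apply: le_trans (cusum_ge_sum m v n w) _.
rewrite leNgt; apply/negP => bS; move: r; rewrite /reached /= -addnS.
move=> /le_trans/(_ (tau_DR_le (ltn0Sn _) (ex_intro _ m (ltW bS)))).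
by rewrite lee_fin ler_nat; lia.
Qed.

(** The exponential of the CuSum is a maximum over change-points of likelihood
    ratios, and the Shiryaev-Roberts statistic is their sum. *)
Lemma expR_cusum_le m k w :
  (Num.max (expR (cusum X (l m) k w)) 1 <=
   1 + shiryaev_roberts X (expR \o l m) k w)%R.
Proof.
elim: k => [|k IH] /=; first by rewrite expR0 addr0 maxxx.
have L0 x : (0 <= (expR \o l m) x)%R by exact: expR_ge0.
have S0 := shiryaev_roberts_ge0 X k w L0.
rewrite ge_max lerDl mulr_ge0 ?expR_ge0 ?addr_ge0// andbT.
apply: (@le_trans _ _ (expR (Num.max (cusum X (l m) k w) 0 + l m (X k.+1 w)))%R).
  by [].
rewrite expRD ler_wpDl// ler_wpM2r ?expR_ge0//.
rewrite addrC; apply: le_trans IH.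
have [h|h] := leP (cusum X (l m) k w) 0%R.
  by rewrite expR0 le_max lexx orbT.
by rewrite le_max lexx.
Qed.

Lemma tau_DR_test_class (Pr : probability Omega R) (Q : probability T R) (g : R) :
  independent_with_laws Pr X (fun=> Q) ->
  (forall m, \int[Q]_x (expR (l m x))%:E = 1) -> (0 < M)%N ->
  (0 < g)%R -> b = ln (M%:R * g) -> test_class X Pr g tau.
Proof.
move=> XQ L1 M0 g0 bE; split; first exact: stopping_time_tau_DR.
have M0' : (0 < M%:R :> R)%R by rewrite ltr0n.
have mL m : measurable_fun setT (expR \o l m).
  by apply: measurableT_comp; [exact: measurable_expR|exact: ml].
have L0 m x : (0 <= (expR \o l m) x)%R by exact: expR_ge0.
have := @average_run_length_ge _ _ _ _ _ X Pr Q XQ M (fun m => expR \o l m)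
  mL L0 L1 tau stopping_time_tau_DR (M%:R * g)%R.
rewrite EFinM => arl; rewrite -(@lee_pmul2l _ M%:R%:E) ?lte_fin//.
apply: arl => //.
- by rewrite mulr_ge0// ltW.
- exact: reached_tau_DR1.
move=> k w k1 tw; case: (tau_DR_cases w) => [|[j [_ [m bm]]]].
  by rewrite tw.
rewrite tw => -[] /eqP; rewrite eqr_nat => /eqP jk; rewrite -{}jk in bm.
have -> : (M%:R * g = expR b)%R by rewrite bE lnK// posrE mulr_gt0.
apply: (@le_trans _ _ (shiryaev_roberts X (expR \o l m) k w)); last first.
  rewrite (bigD1 m)//= lerDl sumr_ge0// => i _.
  exact: shiryaev_roberts_ge0.
case: k k1 bm {tw} => // k _ bm.
apply: (@le_trans _ _ (expR (cusum X (l m) k.+1 w))); first by rewrite ler_expR.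
rewrite /= expRD ler_wpM2r ?expR_ge0// addrC.
apply: le_trans (expR_cusum_le m k w).
by have [h|h] := leP (cusum X (l m) k w) 0%R; rewrite ?expR0 le_max lexx ?orbT.
Qed.

Lemma WADD_tau_DR_le (Pnu : nat -> probability Omega R) (Q P : probability T R)
    (m : 'I_M) (K I : R) :
  (forall nu, (1 <= nu)%N ->
    independent_with_laws (Pnu nu) X (fun k => if (k < nu)%N then Q else P)) ->
  (forall x, l m x <= K)%R -> \int[P]_x (K - l m x)%:E <= (K - I)%:E ->
  (0 < I)%R -> (0 <= K)%R -> (0 <= b)%R ->
  WADD X Pnu tau <= ((b + K) / I)%:E.
Proof.
move=> XP lK PI I0 K0 b0.
have tauP := stopping_time_tau_DR.
apply/(WADD_leP tauP); first by rewrite divr_ge0 ?addr_ge0// ltW.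
move=> [//|v] A _ FA.
apply: (delay_sum_le tauP (XP v.+1 isT) _ (ml m) lK PI) => // [k vk|n w].
  by rewrite ltnS leqNgt vk.
exact: overshoot.
Qed.

End dr_cusum.

(** * Exponential densities and relative entropy *)

Section expR_bounds.
Context {R : realType}.
Implicit Types x y h : R.

Lemma expR_le_quadratic y : (expR y <= 1 + y + y ^+ 2 * expR `|y|)%R.
Proof.
have key : (expR y - 1 <= y * expR y)%R.
  have := expR_ge1Dx (- y); rewrite -(ler_pM2r (expR_gt0 y)) -expRD.
  by rewrite addNr expR0; lra.
have [y0|y0] := leP 0%R y.
  rewrite ger0_norm//; have : (y * (expR y - 1) <= y * (y * expR y))%R.
    by rewrite ler_wpM2l.
  by rewrite expr2; lra.
have e1 : (1 <= expR `|y|)%R by rewrite -expR0 ler_expR.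
have : (y ^+ 2 * 1 <= y ^+ 2 * expR `|y|)%R by rewrite ler_wpM2l ?sqr_ge0.
have : (y * (expR y - 1) <= y * y)%R.
  by apply: ler_wnM2l; [exact: ltW|have := expR_ge1Dx y; lra].
by rewrite expr2; lra.
Qed.

Lemma sqr_le_expR x : (x ^+ 2 <= 16 * expR (`|x| / 2))%R.
Proof.
have -> : (`|x| / 2 = `|x| / 4 + `|x| / 4)%R by field.
have h : (1 + `|x| / 4 <= expR (`|x| / 4))%R by exact: expR_ge1Dx.
have h0 : (0 <= `|x| / 4)%R by rewrite divr_ge0.
rewrite expRD -real_normK ?num_real//.
have : ((1 + `|x| / 4) * (1 + `|x| / 4) <= expR (`|x| / 4) * expR (`|x| / 4))%R.
  by apply: ler_pM => //; rewrite addr_ge0.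
by have := normr_ge0 x; nra.
Qed.

(** First-order expansion in [h], for unbounded [x]: the factor of the remainder
    is made of [exp x] and [exp (- x)], which are integrable for a log-density
    that is bounded above. *)
Lemma expR_le_first_order x h : (0 <= h <= 2^-1)%R ->
  (expR (- (h * x)) <= 1 - h * x + h ^+ 2 * (16 * (expR x + expR (- x))))%R.
Proof.
move=> /andP[h0 h2]; apply: le_trans (expR_le_quadratic _) _.
rewrite lerD2l sqrrN exprMn -mulrA ler_wpM2l ?sqr_ge0//.
have e1 : (expR `|- (h * x)| <= expR (`|x| / 2))%R.
  rewrite ler_expR normrN normrM ger0_norm// mulrC ler_wpM2l//.
have e2 : (expR (`|x| / 2) * expR (`|x| / 2) <= expR x + expR (- x))%R.
  rewrite -expRD -splitr; case: (leP 0%R x) => x0.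
    by rewrite ?ger0_norm// lerDl expR_ge0.
  by rewrite ?ltr0_norm// lerDr expR_ge0.
apply: (@le_trans _ _ (16 * expR (`|x| / 2) * expR (`|x| / 2))%R).
  by apply: ler_pM; rewrite ?sqr_ge0 ?expR_ge0// sqr_le_expR.
by rewrite -mulrA ler_wpM2l.
Qed.

End expR_bounds.

Section exponential_density.
Context {d} {T : measurableType d} {R : realType}.
Variables (P Q : probability T R) (l : T -> R) (K : R).
Hypothesis ml : measurable_fun setT l.
Hypothesis lK : forall x, (l x <= K)%R.
Hypothesis K0 : (0 <= K)%R.
Hypothesis PQ : forall A, measurable A -> P A = \int[Q]_(x in A) (expR (l x))%:E.

Let mexp (f : T -> R) : measurable_fun setT f ->
  measurable_fun setT (fun x => expR (f x)).
Proof. by move=> mf; apply: measurableT_comp. Qed.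

Let mopp : measurable_fun setT (fun x => - l x)%R.
Proof. exact: measurableT_comp. Qed.

Lemma exponential_density_inv A : measurable A ->
  Q A = \int[P]_(x in A) (expR (- l x))%:E.
Proof.
move=> mA; rewrite integral_mkcond.
rewrite (ge0_integral_density (mexp ml) _ PQ); first last.
- by move=> x; rewrite patchE; case: ifPn => // _; rewrite lee_fin expR_ge0.
- apply/(measurable_restrictT _ mA)/measurable_funTS/measurable_EFinP.
  exact: mexp.
- by move=> x; exact: expR_ge0.
rewrite -[LHS]mul1e -integral_cst// integral_mkcond.
apply: eq_integral => x _; rewrite !patchE; case: ifPn => _.
  by rewrite -EFinM -expRD addNr expR0.
by rewrite [X in X * _](_ : _ = 0)// mul0e.
Qed.

Lemma integral_expRN : \int[P]_x (expR (- l x))%:E = 1.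
Proof. by rewrite -exponential_density_inv// probability_setT. Qed.

Let mKl : measurable_fun setT (fun x => (K - l x)%:E).
Proof. by apply/measurable_EFinP; apply: measurable_funB. Qed.

(** The mean of [l] is finite as [- l <= exp (- l)], which has mean 1. *)
Lemma integral_gap_fin : \int[P]_x (K - l x)%:E \is a fin_num.
Proof.
rewrite ge0_fin_numE; last by apply: integral_ge0 => x _; rewrite lee_fin subr_ge0.
apply: (@le_lt_trans _ _ (\int[P]_x ((expR (- l x))%:E + K%:E))).
  apply: ge0_le_integral => //.
  - by move=> x _; rewrite lee_fin subr_ge0.
  - by apply: emeasurable_funD => //; apply/measurable_EFinP; exact: mexp.
  - move=> x _; rewrite -EFinD lee_fin.
    by have := expR_ge1Dx (- l x); lra.
rewrite ge0_integralD//.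
- rewrite integral_expRN integral_cst// [X in _ * X]probability_setT mule1.
  by rewrite -EFinD ltry.
- by apply/measurable_EFinP; exact: mexp.
Qed.

(** The mean of the log-density [l] under [P], computed from the nonnegative
    function [K - l] because [l] may be unbounded below. *)
Definition entropy : R := (K - fine (\int[P]_x (K - l x)%:E))%R.

Lemma integral_gap : \int[P]_x (K - l x)%:E = (K - entropy)%:E.
Proof. by rewrite /entropy subKr fineK// integral_gap_fin. Qed.

Let g x := (expR (- l x) - 1 + l x)%R.

Let g0 x : (0 <= g x)%R.
Proof. by rewrite /g; have := expR_ge1Dx (- l x); lra. Qed.

Let mg : measurable_fun setT g.
Proof.
by apply: measurable_funD => //; apply: measurable_funB => //; exact: mexp.
Qed.

(** As [exp (- l)] has mean 1, the relative entropy is the mean of the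
    nonnegative function [g], which vanishes only where [l] does. *)
Let integral_g : \int[P]_x (g x)%:E = entropy%:E.
Proof.
have gfin : \int[P]_x (g x)%:E + (K - entropy + 1)%:E = (1 + K)%:E.
  transitivity (\int[P]_x ((g x)%:E + ((K - l x)%:E + 1%:E))).
    rewrite ge0_integralD//; first last.
    - by apply: emeasurable_funD.
    - by move=> x _; rewrite -EFinD lee_fin addr_ge0// subr_ge0.
    - exact/measurable_EFinP.
    - by move=> x _; rewrite lee_fin.
    rewrite ge0_integralD//; last by move=> x _; rewrite lee_fin subr_ge0.
    by rewrite integral_cst// [X in _ * X]probability_setT mule1 integral_gap.
  transitivity (\int[P]_x ((expR (- l x))%:E + K%:E)).
    by apply: eq_integral => x _; rewrite -!EFinD; congr EFin; rewrite /g; ring.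
  rewrite ge0_integralD//.
  - by rewrite integral_expRN integral_cst// [X in _ * X]probability_setT mule1.
  - by apply/measurable_EFinP; exact: mexp.
have : \int[P]_x (g x)%:E \is a fin_num.
  by move: gfin; case: (\int[P]_x _).
move: gfin; case: (\int[P]_x _) => // t [] te _; congr EFin; lra.
Qed.

Lemma entropy_ge0 : (0 <= entropy)%R.
Proof.
by rewrite -lee_fin -integral_g; apply: integral_ge0 => x _; rewrite lee_fin.
Qed.

Lemma entropy_eq0 : entropy = 0%R -> forall A, measurable A -> P A = Q A.
Proof.
move=> e0 A mA; rewrite exponential_density_inv//.
have : ae_eq P setT (EFin \o g) (cst 0).
  apply/(ae_eq_integral_abs P measurableT); first exact/measurable_EFinP.
  rewrite -[RHS]/(0%:E) -e0 -integral_g; apply: eq_integral => x _.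
  by rewrite /= ger0_norm.
move=> gae; rewrite -[LHS]mul1e -integral_cst//.
apply: ge0_ae_eq_integral => //.
- apply/measurable_EFinP/measurable_funTS; exact: mexp.
apply: filterS gae => x /(_ I)/= [] gx _; congr EFin.
have [->|l0] := eqVneq (l x) 0%R; first by rewrite oppr0 expR0.
have : (1 - l x < expR (- l x))%R by apply: expR_gt1Dx; rewrite oppr_eq0.
by move: gx; rewrite /g; lra.
Qed.

Lemma KL_entropy : KL P Q = entropy%:E.
Proof.
have PllQ : P `<< Q.
  apply/null_content_dominatesP => A mA QA.
  rewrite PQ// null_set_integral//; apply/measurable_funTS/measurable_EFinP.
  exact: mexp.
rewrite /KL asboolT//.
have Qae : ae_eq Q setT ('d (charge_of_finite_measure P) '/d Q)
    (fun x => (expR (l x))%:E).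
  apply: integral_ae_eq => //.
  - exact: Radon_Nikodym_integrable.
  - by apply/measurable_EFinP; exact: mexp.
  - by move=> A _ mA; rewrite -Radon_Nikodym_integral// -PQ.
have Pae : ae_eq P setT (fun x => lne ('d (charge_of_finite_measure P) '/d Q x))
    (EFin \o l).
  case: Qae => N [mN QN0 sub]; exists N; split => //.
    apply: (etrans (PQ mN)); rewrite null_set_integral//.
    by apply/measurable_funTS/measurable_EFinP; exact: mexp.
  apply: subset_trans sub => x /= /not_implyP[_ ne]; apply: contra_not ne.
  by move=> /(_ I) ->; rewrite lne_EFin ?expR_gt0// expRK.
have mRN : measurable_fun setT
    (fun x => lne ('d (charge_of_finite_measure P) '/d Q x)).
  pose f x := fine ('d (charge_of_finite_measure P) '/d Q x).
  have mf : measurable_fun setT f.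
    by apply: measurableT_comp => //; exact: measurable_fine.
  rewrite (_ : (fun x => _) = fun x => if (f x <= 0)%R then -oo else (ln (f x))%:E).
    apply: measurable_fun_ifT => //; first exact: measurable_fun_ler.
    by apply/measurable_EFinP; exact: measurableT_comp.
  apply/funext => x.
  have RNfin : 'd (charge_of_finite_measure P) '/d Q x \is a fin_num.
    exact: Radon_Nikodym_fin_num.
  by rewrite /f -{1}(fineK RNfin).
rewrite (@ae_eq_integral _ _ _ _ _ _ _ _ _ _ Pae)//; last exact/measurable_EFinP.
transitivity (\int[P]_x (K%:E - (K - l x)%:E)).
  by apply: eq_integral => x _; rewrite -EFinB /= subKr.
rewrite (@integralB_EFin _ _ _ _ _ (cst K) (fun x => K - l x)%R)//.
- have cK : \int[P]_x K%:E = K%:E.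
    by rewrite integral_cst// [X in _ * X]probability_setT mule1.
  by rewrite /= cK integral_gap -EFinB subKr.
- exact: finite_measure_integrable_cst.
- apply/integrableP; split => //.
  have := integral_gap_fin; rewrite ge0_fin_numE; last first.
    by apply: integral_ge0 => x _; rewrite lee_fin subr_ge0.
  apply: le_lt_trans; rewrite le_eqVlt; apply/orP; left; apply/eqP.
  by apply: eq_integral => x _ /=; rewrite ger0_norm// subr_ge0.
Qed.

(** Expanding [exp (- (h * l))] to first order, the terms of order [h] give the
    claim; the remainder is of order [h ^+ 2] because both [exp l <= exp K] and
    [exp (- l)] are integrable. *)
Lemma entropy_le_of_scaling (a : R) :
  (forall h, (0 <= h <= 2^-1)%R ->
     (expR (- (h * a)))%:E <= \int[P]_x (expR (- (h * l x)))%:E) ->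
  (entropy <= a)%R.
Proof.
move=> H; pose B := (16 * (expR K + 1))%R.
have B0 : (0 < B)%R by rewrite mulr_gt0// addr_gt0// expR_gt0.
have mel h : measurable_fun setT (fun x => (expR (- (h * l x)))%:E).
  apply/measurable_EFinP; apply: mexp; apply: measurableT_comp => //.
  exact: measurable_funM.
have step h : (0 <= h <= 2^-1)%R -> (h * (entropy - a) <= h ^+ 2 * B)%R.
  move=> h01; have /andP[h0 _] := h01.
  have : (expR (- (h * a)) + h * K)%:E <=
      (1 + h * (K - entropy) + h ^+ 2 * B)%:E.
    apply: (@le_trans _ _ (\int[P]_x ((expR (- (h * l x)))%:E + (h * K)%:E))).
      rewrite ge0_integralD//; last by move=> x _; rewrite lee_fin mulr_ge0.
      rewrite EFinD integral_cst// [X in _ * X]probability_setT mule1.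
      by rewrite leeD2r// H.
    pose C := (1 + h ^+ 2 * 16 * expR K)%R.
    have C0 : (0 <= C)%R.
      by rewrite addr_ge0// !mulr_ge0 ?sqr_ge0 ?expR_ge0.
    have h16 : (0 <= h ^+ 2 * 16)%R by rewrite mulr_ge0 ?sqr_ge0.
    have mh : measurable_fun setT (fun x => h%:E * (K - l x)%:E).
      exact: emeasurable_funM.
    have me : measurable_fun setT (fun x => (h ^+ 2 * 16)%:E * (expR (- l x))%:E).
      by apply: emeasurable_funM => //; apply/measurable_EFinP; exact: mexp.
    have hge x : 0 <= h%:E * (K - l x)%:E by rewrite mule_ge0// lee_fin subr_ge0.
    have ege x : 0 <= (h ^+ 2 * 16)%:E * (expR (- l x))%:E.
      by rewrite mule_ge0// lee_fin expR_ge0.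
    apply: (@le_trans _ _ (\int[P]_x (C%:E + (h%:E * (K - l x)%:E +
        (h ^+ 2 * 16)%:E * (expR (- l x))%:E)))).
      apply: ge0_le_integral => //.
      - by move=> x _; rewrite -EFinD lee_fin addr_ge0 ?expR_ge0// mulr_ge0.
      - by apply: emeasurable_funD.
      - by apply: emeasurable_funD => //; exact: emeasurable_funD.
      move=> x _; rewrite -!EFinM -!EFinD lee_fin /C.
      have := expR_le_first_order (l x) h01.
      have : (h ^+ 2 * 16 * expR (l x) <= h ^+ 2 * 16 * expR K)%R.
        by rewrite ler_wpM2l// ler_expR.
      by lra.
    rewrite ge0_integralD//; first last.
    - exact: emeasurable_funD.
    - by move=> x _; rewrite adde_ge0.
    rewrite ge0_integralD// !ge0_integralZl//.
    - rewrite integral_cst// [X in _ * X]probability_setT mule1 integral_gap.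
      rewrite integral_expRN mule1 -!EFinM -!EFinD lee_fin /C /B; lra.
    - by apply/measurable_EFinP; exact: mexp.
    - by move=> x _; rewrite lee_fin subr_ge0.
  rewrite lee_fin; have := expR_ge1Dx (- (h * a)); lra.
rewrite leNgt; apply/negP => ae.
(* Small enough for the remainder to take at most half of the gap. *)
pose h := (Num.min 2^-1 ((entropy - a) / (2 * B)))%R.
have ea : (0 < entropy - a)%R by rewrite subr_gt0.
have h0 : (0 < h)%R by rewrite lt_min invr_gt0 ltr0n/= divr_gt0// mulr_gt0.
have hB : (h * B <= (entropy - a) / 2)%R.
  apply: (@le_trans _ _ ((entropy - a) / (2 * B) * B)%R).
    by rewrite ler_wpM2r ?(ltW B0)// ge_min lexx orbT.
  by rewrite le_eqVlt; apply/orP; left; apply/eqP; field; rewrite gt_eqF.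
have := step h; rewrite (ltW h0) ge_min lexx => /(_ isT).
by rewrite expr2 -mulrA ler_pM2l//; lra.
Qed.

End exponential_density.

(** * Densities, empirical measures and finite minima *)

Section finite_minimum.
Context {R : realType} (n : nat).
Implicit Types F : 'I_n.+1 -> R.

(** The bare shape of [cost], as a function of the terms to be minimized. *)
Definition finmin F : R := \big[Num.min/F ord0]_(j < n.+1) F j.

Lemma finmin_le F j : (finmin F <= F j)%R.
Proof. by rewrite /finmin (bigD1 j)//= ge_min lexx. Qed.

Lemma finmin_attained F : exists j, finmin F = F j.
Proof.
rewrite /finmin; elim/big_ind : _ => [|x y [i ->] [j ->]|j _].
- by exists ord0.
- by rewrite /Num.min; case: ifP => _; [exists i|exists j].
- by exists j.
Qed.

Lemma measurable_finmin d (T : measurableType d) (D : set T)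
    (F : 'I_n.+1 -> T -> R) : (forall j, measurable_fun D (F j)) ->
  measurable_fun D (fun x => finmin (F^~ x)).
Proof.
move=> mF; rewrite /finmin; elim: (index_enum _) => [|j e IH].
  by under eq_fun do rewrite big_nil; exact: mF.
by under eq_fun do rewrite big_cons; exact: measurable_minr.
Qed.

End finite_minimum.

Lemma measurable_set1_tuple {R : realType} (d : nat) (x : d.-tuple R) :
  measurable [set x].
Proof.
rewrite (_ : [set x] = \bigcap_(i in [set: 'I_d])
    ((fun y : d.-tuple R => tnth y i) @^-1` [set tnth x i])).
  apply: fin_bigcap_measurable => // i _; rewrite -[X in measurable X]setTI.
  exact: (@measurable_tnth _ R d i measurableT _ (measurable_set1 _)).
apply/seteqP; split=> [y ->//|y xy].
by apply: eq_from_tnth => i; exact: xy.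
Qed.

Section densities.
Context {disp} {T : measurableType disp} {R : realType}.
Variables (mu : {measure set T -> \bar R}) (D : set T).
Hypothesis mD : measurable D.

Lemma has_pdf_setD (P : probability T R) (p : T -> R) : has_pdf mu D P p -> P D = 1.
Proof.
move=> [_ _ PE]; rewrite -(probability_setT P) !PE//.
by rewrite setTI setIid.
Qed.

Lemma has_pdf_integral (P : probability T R) (p : T -> R) (f : T -> \bar R) :
  has_pdf mu D P p -> measurable_fun D f -> (forall x, D x -> 0 <= f x) ->
  \int[P]_(x in D) f x = \int[mu]_(x in D) (f x * (p x)%:E).
Proof.
move=> [mp p0 PE] mf f0.
have p0' x : (0 <= (p \_ D) x)%R by rewrite patchE; case: ifPn => // /set_mem/p0.
have PE' A : measurable A -> P A = \int[mu]_(x in A) ((p \_ D) x)%:E.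
  move=> mA; rewrite PE// integral_mkcondr; apply: eq_integral => x _.
  by rewrite !patchE; case: ifPn.
have mp' : measurable_fun setT (p \_ D) by exact/(measurable_restrictT _ mD).
have mf' : measurable_fun setT (f \_ D) by exact/(measurable_restrictT _ mD).
have f0' x : 0 <= (f \_ D) x by rewrite patchE; case: ifPn => // /set_mem/f0.
transitivity (\int[P]_x (f \_ D) x); first exact: integral_mkcond.
apply: (etrans (ge0_integral_density mp' p0' PE' mf' f0')).
rewrite [RHS]integral_mkcond; apply: eq_integral => x _.
by rewrite !patchE; case: ifPn => // _; exact: mul0e.
Qed.

Lemma integral_full (P : probability T R) (A : set T) (f : T -> \bar R) :
  P D = 1 -> measurable A -> measurable_fun setT f -> (forall x, 0 <= f x) ->
  \int[P]_(x in A `&` D) f x = \int[P]_(x in A) f x.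
Proof.
move=> PD mA mf f0; rewrite [RHS](@ge0_negligible_integral _ _ _ _ _ (A `\` D))//.
- by rewrite setDD.
- exact: measurableD.
- exact: measurable_funTS.
- apply: (@subset_measure0 _ _ _ _ _ (~` D)) => //.
  + exact: measurableD.
  + exact: measurableC.
  by apply: (etrans (probability_setC P mD)); rewrite PD subee.
Qed.

End densities.

Section empirical_measure.
Context {disp} {T : measurableType disp} {R : realType} (n : nat).
Variable omega : 'I_n.+1 -> T.

Lemma integral_empirical (f : T -> \bar R) :
  measurable_fun setT f -> (forall x, 0 <= f x) ->
  \int[empirical omega]_x f x =
  (n.+1%:R^-1 : R)%:E * \sum_(j < n.+1) f (omega j).
Proof.
move=> mf f0; have w0 : (0 <= n.+1%:R^-1 :> R)%R by rewrite invr_ge0.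
rewrite (eq_measure_integral (mscale (NngNum w0)
  (msum (fun j => \d_(omega (inord j)) : {measure set T -> \bar R}) n.+1))).
  rewrite ge0_integral_mscale// ge0_integral_measure_sum//=; congr (_ * _).
  by apply: eq_bigr => j _; rewrite integral_dirac// diracT mul1e inord_val.
move=> A mA _; rewrite /= /empirical /mscale/= /msum; congr (_ * _).
by apply: eq_bigr => j _; rewrite inord_val.
Qed.

Lemma empirical_support : (forall x : T, measurable [set x]) ->
  empirical omega (~` range omega) = 0 :> \bar R.
Proof.
move=> m1; rewrite /= /empirical big1 ?mule0// => j _.
rewrite diracE memNset//; apply; by exists j.
Qed.

End empirical_measure.

Lemma poweR_le_inv {R : realType} (t : \bar R) (s r : R) :
  (1 <= s)%R -> (0 <= r)%R -> 0 <= t -> t `^ (s^-1)%R <= r%:E -> t <= (r `^ s)%:E.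
Proof.
move=> s1 r0; have s0 : (0 < s)%R by exact: lt_le_trans s1.
case: t => [t||//]; rewrite ?lee_fin.
  move=> t0 tr.
  have : ((t `^ s^-1) `^ s <= r `^ s)%R.
    by apply: ge0_ler_powR; rewrite ?nnegrE ?powR_ge0// ltW.
  by rewrite -powRrM mulVf ?gt_eqF// powRr1.
by move=> _ /=; rewrite invr_eq0 gt_eqF// leye_eq.
Qed.

(** * Duality for Wasserstein balls *)

(** Probabilities are functions on all sets, so two of them that agree on
    measurable sets need not be equal; the ball does not tell them apart. *)
Lemma eq_wasserstein_ball {disp} {T : measurableType disp} {R : realType}
    (D : set T) (c : T -> T -> R) (s r : R) (P0 P1 P2 : probability T R) :
  measurable D -> (forall A, measurable A -> P1 A = P2 A) ->
  wasserstein_ball D c s P0 r P1 -> wasserstein_ball D c s P0 r P2.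
Proof.
move=> mD P12 [[PD Pm] W]; split.
  split; first by rewrite -P12.
  move=> x0 Dx0; rewrite (eq_measure_integral P1); first exact: Pm.
  by move=> A mA _; exact/esym/P12.
suff E : couplings P2 P0 = couplings P1 P0 by rewrite /wasserstein E.
by apply/seteqP; split=> G GP A mA; have [G1 G2] := GP A mA; rewrite ?P12// -?P12//.
Qed.

Section duality.
Context {disp} {T : measurableType disp} {R : realType}.
Variables (mu : {measure set T -> \bar R}) (D : set T) (c : T -> T -> R).
Variables (s r : R) (Q : probability T R) (q : T -> R).
Variables (n : nat) (omega : 'I_n.+1 -> T).
Variables (Pstar : probability T R) (lam : R) (u : 'I_n.+1 -> R).
Hypothesis m1 : forall x : T, measurable [set x].
Hypothesis mD : measurable D.
Hypothesis mc : measurable_fun (D `*` D) (fun z => c z.1 z.2).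
Hypothesis s1 : (1 <= s)%R.
Hypothesis Domega : forall j, D (omega j).
Hypothesis r0 : (0 <= r)%R.
Hypothesis Qq : has_pdf mu D Q q.
Hypothesis dual : dual_maximizer mu D c s r q omega lam u.
Hypothesis Pstarq :
  has_pdf mu D Pstar (fun x => q x * expR (llr mu D c s q omega lam u x))%R.

Let ell := llr mu D c s q omega lam u.
Let L := ln (Defs.eta mu D c s q omega lam u).
Let ell0 := ell \_ D.
(* Bounds [ell] above because [cost] is at least the minimum of the [- u j]. *)
Let K := (\sum_j `|u j| + `|L|)%R.
Let V := dual_objective mu D c s r q omega lam u.
Let costE l v x :
  cost c s omega l v x = finmin (fun j => l * c x (omega j) `^ s - v j)%R.
Proof. by []. Qed.

Let K0 : (0 <= K)%R.
Proof. by rewrite addr_ge0// sumr_ge0. Qed.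

Let uK j : (u j <= \sum_j `|u j|)%R.
Proof.
rewrite (bigD1 j)//=; apply: le_trans (ler_norm (u j)) _.
by rewrite lerDl sumr_ge0.
Qed.

Lemma measurable_cost l v : measurable_fun D (cost c s omega l v).
Proof.
apply: (measurable_finmin (F := fun j x => (l * c x (omega j) `^ s - v j)%R)) => j.
apply: measurable_funB => //; apply: measurable_funM => //.
apply: (measurableT_comp (measurable_powR _)).
apply: (measurable_comp (F := D `*` D) (f := fun z => c z.1 z.2)
  (g := fun x => (x, omega j))) => //.
- exact: measurableX.
- by move=> _ [x Dx <-]; split => /=.
- apply: measurable_funTS; apply/measurable_fun_pairP.
  by split; [exact: measurable_id|exact: measurable_cst].
Qed.

Lemma cost_scale t x : (0 <= t)%R ->
  cost c s omega (t * lam)%R (fun j => t * u j)%R x = (t * cost c s omega lam u x)%R.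
Proof.
move=> t0; rewrite !costE; apply/eqP; rewrite eq_le; apply/andP; split.
  have [j ->] := finmin_attained (fun j => lam * c x (omega j) `^ s - u j)%R.
  by apply: le_trans (finmin_le _ j) _; rewrite mulrBr mulrA.
have [j ->] := finmin_attained (fun j => t * lam * c x (omega j) `^ s - t * u j)%R.
by rewrite -mulrA -mulrBr ler_wpM2l// finmin_le.
Qed.

Let lam0 : (0 <= lam)%R. Proof. by have [] := dual. Qed.

Let ellK x : (ell x <= K)%R.
Proof.
rewrite /ell /llr costE.
have [j ->] := finmin_attained (fun j => lam * c x (omega j) `^ s - u j)%R.
have : (0 <= lam * c x (omega j) `^ s)%R by rewrite mulr_ge0// powR_ge0.
have := uK j; have := ler_norm (- L); rewrite normrN -/L /K; lra.
Qed.

Let ell0E x : D x -> ell0 x = ell x.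
Proof. by move=> Dx; rewrite /ell0 patchE mem_set. Qed.

Let ell0K x : (ell0 x <= K)%R.
Proof. by rewrite /ell0 patchE; case: ifPn. Qed.

Let mell : measurable_fun D ell.
Proof.
apply: measurable_funB => //; apply: measurableT_comp => //.
exact: measurable_cost.
Qed.

Lemma measurable_llr_patch : measurable_fun setT ell0.
Proof. exact/(measurable_restrictT _ mD). Qed.
Let mell0 := measurable_llr_patch.

Let QD : Q D = 1. Proof. exact: has_pdf_setD Qq. Qed.
Let PD : Pstar D = 1. Proof. exact: has_pdf_setD Pstarq. Qed.

Let mexp (f : T -> R) A : measurable_fun A f ->
  measurable_fun A (fun x => (expR (f x))%:E).
Proof. by move=> mf; apply/measurable_EFinP; apply: measurableT_comp. Qed.

Lemma Pstar_density A : measurable A ->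
  Pstar A = \int[Q]_(x in A) (expR (ell0 x))%:E.
Proof.
move=> mA; rewrite -(integral_full mD QD mA (mexp mell0)); last first.
  by move=> x; rewrite lee_fin expR_ge0.
have [_ _ ->//] := Pstarq.
have mAD : measurable (A `&` D) by exact: measurableI.
transitivity (\int[Q]_(x in D) (((fun x => (expR (ell x))%:E) \_ A) x)).
  rewrite (has_pdf_integral mD Qq); first last.
  - by move=> x _; rewrite patchE; case: ifPn => // _; rewrite lee_fin expR_ge0.
  - apply/(measurable_restrict _ mA mD); apply: measurable_funS (mexp mell) => //.
  rewrite [LHS]integral_mkcondl; apply: eq_integral => x /set_mem Dx.
  rewrite !patchE; case: ifPn => _; last by apply/esym; exact: mul0e.
  by rewrite -EFinM mulrC.
rewrite -integral_mkcondl; apply: eq_integral => x /set_mem[_ Dx].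
by rewrite ell0E.
Qed.

Let I := entropy Pstar ell0 K.

(** By homogeneity of the cost, the integral on the right is, up to the factor
    [exp ((1 - h) * L)], the normalizing constant [eta] at the dual variables
    [((1 - h) * lam, (1 - h) * u)], whose dual value is at most [V]. *)
Lemma scaling_lower_bound h : (0 <= h <= 2^-1)%R ->
  (expR (- (h * V)))%:E <= \int[Pstar]_x (expR (- (h * ell0 x)))%:E.
Proof.
move=> /andP[h0 h2]; have h1 : (0 <= 1 - h)%R by lra.
have mh : measurable_fun setT (fun x => (expR (- (h * ell0 x)))%:E).
  by apply: mexp; apply: measurableT_comp => //; exact: measurable_funM.
set E := \int[_]_x _.
have Elow : (expR (- (h * K)))%:E <= E.
  have -> : (expR (- (h * K)))%:E = \int[Pstar]_x (expR (- (h * K)))%:E.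
    by rewrite integral_cst// [X in _ * X]probability_setT mule1.
  apply: ge0_le_integral => //.
  - by move=> x _; rewrite lee_fin ler_expR lerN2 ler_wpM2l.
have etaE : \int[mu]_(x in D) (q x *
    expR (- cost c s omega ((1 - h) * lam)%R (fun j => (1 - h) * u j)%R x))%:E =
    (expR ((1 - h) * L))%:E * E.
  have -> : E = \int[Pstar]_(x in D) (expR (- (h * ell x)))%:E.
    rewrite /E -(integral_full mD PD measurableT mh).
      by rewrite setTI; apply: eq_integral => x /set_mem Dx; rewrite ell0E.
    by move=> x; rewrite lee_fin expR_ge0.
  have mhD : measurable_fun D (fun x => (expR (- (h * ell x)))%:E).
    by apply: mexp; apply: measurableT_comp => //; exact: measurable_funM.
  rewrite (has_pdf_integral mD Pstarq)//.
  have [mp p0 _] := Pstarq.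
  rewrite -ge0_integralZl//; first last.
  - by move=> x Dx; rewrite mule_ge0// lee_fin ?expR_ge0// p0.
  - by apply: emeasurable_funM => //; exact/measurable_EFinP.
  apply: eq_integral => x _; rewrite cost_scale// -!EFinM; congr EFin.
  have gen y A B C : (expR A * (expR B * (y * expR C)) = y * expR (A + B + C))%R.
    by rewrite !expRD; ring.
  rewrite gen; congr (_ * expR _)%R.
  by rewrite /ell /llr -/L; ring.
have [_ /(_ ((1 - h) * lam)%R (fun j => (1 - h) * u j)%R)] := dual.
rewrite mulr_ge0// => /(_ isT); rewrite -/V /dual_objective {1}/Defs.eta etaE.
move: Elow; case: E {etaE} => [e||]//; last by move=> *; exact: leey.
rewrite -EFinM /= !lee_fin => elow.
have e0 : (0 < e)%R by apply: lt_le_trans elow; exact: expR_gt0.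
rewrite lnM ?posrE ?expR_gt0// expRK -mulr_sumr => VV.
rewrite -[X in (_ <= X)%R](lnK (x := e)) ?posrE// ler_expR.
move: VV; rewrite /V /dual_objective -/L.
set a := (\sum_(j < n.+1) u j)%R; set w := (r `^ s)%R; set N := (n.+1%:R^-1)%R.
have -> : (- ((1 - h) * lam) * w = (1 - h) * (- lam * w))%R by ring.
have -> : (N * ((1 - h) * a) = (1 - h) * (N * a))%R by ring.
by lra.
Qed.

Lemma entropy_le_dual : (I <= V)%R.
Proof.
apply: (entropy_le_of_scaling mell0 ell0K K0 Pstar_density) => h h01.
exact: scaling_lower_bound.
Qed.

(** For [y = omega j] one has [- ell x <= L - u j + lam * c x y ^ s]; integrate
    this against [G].  When sample points coincide, [j] is not determined by
    [y] and the best bound is used. *)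
Lemma coupling_integral_le (P : probability T R)
    (G : probability (T * T)%type R) (w : R) :
  P D = 1 -> couplings P (empirical omega) G ->
  \int[G]_(z in D `*` D) ((c z.1 z.2) `^ s)%:E <= w%:E ->
  \int[P]_x (K - ell0 x)%:E <=
  (K + L - n.+1%:R^-1 * (\sum_j u j) + lam * w)%:E.
Proof.
move=> PD1 GP Gw.
pose kap j := (K + L - u j)%R.
have kap0 j : (0 <= kap j)%R.
  have := uK j; have := ler_norm (- L); rewrite normrN /kap /K; lra.
pose B := (\sum_j kap j)%R.
have kapB j : (kap j <= B)%R by rewrite /B (bigD1 j)//= lerDl sumr_ge0.
(* Equal to [kap j] at [omega j] and to the harmless value [B] elsewhere, so
   that [v] is the least [kap j] over the samples at [y]. *)
pose W j y := (B + (kap j - B) * \1_[set omega j] y)%R.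
have W0 j y : (0 <= W j y)%R.
  rewrite /W indicE; have := kap0 j; have := kapB j.
  by case: (_ \in _); rewrite /= ?mulr1 ?mulr0; lra.
pose v y := finmin (W^~ y).
have v0 y : (0 <= v y)%R by rewrite /v; have [j ->] := finmin_attained (W^~ y).
have mv : measurable_fun setT (EFin \o v).
  apply/measurable_EFinP; apply: (@measurable_finmin _ _ _ _ _ W) => j.
  apply: measurable_funD; first exact: measurable_cst.
  apply: measurable_funM; first exact: measurable_cst.
  exact: (@measurable_indic _ _ R setT _ (m1 (omega j))).
have v_omega j : (v (omega j) <= kap j)%R.
  apply: le_trans (finmin_le _ j) _.
  by rewrite /W indicE mem_set// mulr1 addrCA subrr addr0.
pose cs z := (((c z.1 z.2) `^ s)%:E : \bar R).
have mcs : measurable_fun (D `*` D) cs.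
  by apply/measurable_EFinP; apply: (measurableT_comp (measurable_powR _)).
have mDD : measurable (D `*` D) by exact: measurableX.
have cs0 z : 0 <= (cs \_ (D `*` D)) z.
  by rewrite patchE; case: ifPn => // _; rewrite lee_fin powR_ge0.
have mcs' : measurable_fun setT (cs \_ (D `*` D)).
  exact/(measurable_restrictT _ mDD).
have pointwise z : D z.1 -> range omega z.2 ->
    (K - ell0 z.1)%:E <= (v z.2)%:E + lam%:E * (cs \_ (D `*` D)) z.
  move=> Dz1 [j _ jz]; have Dz2 : D z.2 by rewrite -jz.
  rewrite patchE mem_set//= -EFinM -EFinD lee_fin ell0E//.
  rewrite /v; have [i ->] := finmin_attained (W^~ z.2).
  have costle k : (cost c s omega lam u z.1 <= lam * c z.1 (omega k) `^ s - u k)%R.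
    exact: finmin_le.
  have base k : omega k = z.2 -> (K - ell z.1 <= kap k + lam * c z.1 z.2 `^ s)%R.
    move=> <-; have := costle k.
    by rewrite /ell /llr -/L /kap; lra.
  rewrite /W indicE; have [/set_mem zi|_] := boolP (z.2 \in [set omega i]).
    by rewrite mulr1 addrCA subrr addr0; apply: base; exact/esym.
  rewrite mulr0 addr0; apply: le_trans (base j jz) _.
  by rewrite lerD2r.
have m2 : measurable_fun setT (fun z : T * T => (v z.2)%:E).
  exact: (measurableT_comp mv measurable_snd).
have mKl : measurable_fun setT (fun x => (K - ell0 x)%:E).
  by apply/measurable_EFinP; apply: measurable_funB.
have Kl0 x : 0 <= (K - ell0 x)%:E by rewrite lee_fin subr_ge0.
have mKl1 : measurable_fun setT (fun z : T * T => (K - ell0 z.1)%:E).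
  exact: (measurableT_comp mKl measurable_fst).
have mlcs : measurable_fun setT (fun z => lam%:E * (cs \_ (D `*` D)) z).
  exact: emeasurable_funM.
have lcs0 z : 0 <= lam%:E * (cs \_ (D `*` D)) z by rewrite mule_ge0.
have marginal1 (f : T -> \bar R) : measurable_fun setT f -> (forall x, 0 <= f x) ->
    \int[G]_z f z.1 = \int[P]_x f x.
  move=> mf f0; rewrite -(@ge0_integral_pushforward _ _ _ _ _ fst _ G setT f)//.
  - apply: eq_measure_integral => A mA _; apply: etrans (GP A mA).1.
    by rewrite /= /pushforward; congr (G _); apply/seteqP; split=> z //= [].
have marginal2 (f : T -> \bar R) : measurable_fun setT f -> (forall x, 0 <= f x) ->
    \int[G]_z f z.2 = \int[empirical omega]_x f x.
  move=> mf f0; rewrite -(@ge0_integral_pushforward _ _ _ _ _ snd _ G setT f)//.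
  - apply: eq_measure_integral => A mA _; apply: etrans (GP A mA).2.
    by rewrite /= /pushforward; congr (G _); apply/seteqP; split=> z //= [].
have momega : measurable (~` range omega).
  apply: measurableC; rewrite -(bigcup_imset1 setT omega).
  by apply: fin_bigcup_measurable.
have mA1 : measurable (~` D `*` [set: T]).
  by apply: measurableX => //; exact: measurableC.
have mA2 : measurable ([set: T] `*` ~` range omega) by exact: measurableX.
have ZA1 : G (~` D `*` setT) = 0.
  apply: etrans (GP _ (measurableC mD)).1 _.
  by apply: (etrans (probability_setC P mD)); rewrite PD1 subee.
have ZA2 : G (setT `*` ~` range omega) = 0.
  by apply: etrans (GP _ momega).2 _; exact: empirical_support.
rewrite -(marginal1 _ mKl Kl0).
apply: (@le_trans _ _ (\int[G]_z ((v z.2)%:E + lam%:E * (cs \_ (D `*` D)) z))).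
  apply: ae_ge0_le_integral => //.
  - by move=> z _; rewrite adde_ge0// lee_fin.
  - exact: emeasurable_funD.
  exists (~` D `*` setT `|` setT `*` ~` range omega); split.
  - exact: measurableU.
  - exact: null_set_setU.
  move=> z /= nz; apply: contrapT => /not_orP[/not_andP nD /not_andP nO].
  apply: nz => _; apply: pointwise.
    by case: nD => // /contrapT.
  by case: nO => // /contrapT.
rewrite ge0_integralD//; last by move=> z _; rewrite lee_fin.
rewrite ge0_integralZl// EFinD; apply: leeD; last first.
  by rewrite EFinM lee_wpmul2l ?lee_fin// -integral_mkcond.
rewrite (marginal2 (EFin \o v) mv); last by move=> y; rewrite lee_fin.
rewrite (integral_empirical omega mv); last by move=> y; rewrite lee_fin.
apply: (@le_trans _ _ ((n.+1%:R^-1)%:E * (\sum_(j < n.+1) kap j)%:E)).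
  rewrite lee_wpmul2l// -sumEFin; apply: lee_sum => j _.
  by rewrite lee_fin.
rewrite -EFinM lee_fin /kap sumrB sumr_const card_ord.
rewrite -(mulr_natl (K + L)%R) mulrBr mulrA.
by rewrite mulVf ?pnatr_eq0// mul1r.
Qed.

(** The minimal cost of a coupling is approached within [e / (lam + 1)], which
    the multiplier [lam] turns into an error of at most [e]. *)
Lemma weak_duality (P : probability T R) :
  wasserstein_ball D c s (empirical omega) r P ->
  \int[P]_x (K - ell0 x)%:E <= (K - V)%:E.
Proof.
move=> [[PD1 _] W].
rewrite /wasserstein in W; set t := ereal_inf _ in W.
have t0 : 0 <= t.
  apply: le_ereal_inf_tmp => _ [G _ <-]; apply: integral_ge0 => z _.
  by rewrite lee_fin powR_ge0.
have tr : t <= (r `^ s)%:E by exact: poweR_le_inv W.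
apply/lee_addgt0Pr => e e0.
have l10 : (0 < lam + 1)%R by have := lam0; lra.
have e1 : (0 < e / (lam + 1))%R by rewrite divr_gt0.
have : t < (r `^ s + e / (lam + 1))%:E.
  by apply: le_lt_trans tr _; rewrite lte_fin ltrDl.
move=> /ereal_inf_lt[_ [G GP <-]] /ltW Gw.
apply: le_trans (coupling_integral_le PD1 GP Gw) _.
rewrite -EFinD lee_fin.
have : (lam * (e / (lam + 1)) <= e)%R.
  rewrite mulrA ler_pdivrMr// mulrC ler_wpM2l ?(ltW e0)//; lra.
have -> : V = (- lam * r `^ s + n.+1%:R^-1 * \sum_(j < n.+1) u j - L)%R by [].
by set a := (n.+1%:R^-1 * _)%R; set w := (r `^ s)%R; rewrite mulrDr mulNr; lra.
Qed.

(** What the sequential analysis uses of a least favorable distribution: the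
    log-likelihood ratio is bounded above, normalized, and its mean over the
    ball is smallest at [Pstar], where it is the positive number [I]. *)
Lemma least_favorable_distribution :
  wasserstein_ball D c s (empirical omega) r Pstar ->
  ~ wasserstein_ball D c s (empirical omega) r Q ->
  exists K I : R, [/\ (0 <= K)%R, (forall x, ell0 x <= K)%R, (0 < I)%R &
    KL Pstar Q = I%:E] /\
    [/\ \int[Q]_x (expR (ell0 x))%:E = 1,
        (forall A, measurable A -> Q A = \int[Pstar]_(x in A) (expR (- ell0 x))%:E),
        (K - I)%:E <= \int[Pstar]_x (K - ell0 x)%:E &
        forall P, wasserstein_ball D c s (empirical omega) r P ->
          \int[P]_x (K - ell0 x)%:E <= (K - I)%:E].
Proof.
move=> ballP ballQ; exists K, I; split; split => //.
- rewrite lt_neqAle (entropy_ge0 mell0 ell0K K0 Pstar_density) andbT eq_sym.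
  apply/eqP => I0; apply: ballQ; apply: eq_wasserstein_ball ballP => //.
  exact: (entropy_eq0 mell0 ell0K K0 Pstar_density I0).
- exact: (KL_entropy mell0 ell0K K0 Pstar_density).
- by rewrite -Pstar_density// probability_setT.
- exact: (exponential_density_inv mell0 Pstar_density).
- by rewrite (integral_gap mell0 ell0K K0 Pstar_density).
move=> P /weak_duality/le_trans; apply.
by rewrite lee_fin lerB// entropy_le_dual.
Qed.

End duality.

(** * First-order asymptotics *)

Section asymptotics.
Context {R : realType}.
Implicit Types g t I C : R.

Lemma bigmine_attained (M : nat) (f : 'I_M -> \bar R) : (0 < M)%N ->
  exists m0, \big[mine/+oo]_(m < M) f m = f m0 /\
    forall m, \big[mine/+oo]_(m < M) f m <= f m.
Proof.
move=> M0; have ub m : \big[mine/+oo]_(m < M) f m <= f m.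
  by rewrite (bigD1 m)//= ge_min lexx.
suff [m0 E] : exists m0, \big[mine/+oo]_(m < M) f m = f m0 by exists m0.
have : \big[mine/+oo]_(m < M) f m = +oo \/
    exists m0, \big[mine/+oo]_(m < M) f m = f m0.
  elim/big_ind : _ => [|x y hx hy|m _]; [by left| |by right; exists m].
  by rewrite /mine; case: ifP.
case=> [foo|//]; exists (Ordinal M0); apply/eqP.
by rewrite foo eq_sym -leye_eq -foo ub.
Qed.

Lemma cvg0_of_le_sqrt_ln (o : R -> R) C :
  (\forall g \near +oo%R, (`|o g| <= C / Num.sqrt (ln g))%R) ->
  o x @[x --> +oo%R] --> (0%R : R).
Proof.
move=> oC; apply/cvgrPdist_lt => e e0; near=> g.
rewrite sub0r normrN; apply: le_lt_trans (near oC g _) _ => //.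
pose B := (`|C| / e + 1)%R.
have B0 : (0 < B)%R by rewrite ltr_wpDl// divr_ge0// ltW.
have gB : (expR (B ^+ 2) < g)%R by near: g; exact: nbhs_pinfty_gt.
have g0 : (0 < g)%R by apply: lt_trans gB; exact: expR_gt0.
have Bs : (B <= Num.sqrt (ln g))%R.
  rewrite -[X in (X <= _)%R](@ger0_norm _ B) ?(ltW B0)// -sqrtr_sqr ler_sqrt.
    by rewrite -[X in (X <= _)%R]expRK ler_ln ?posrE ?expR_gt0// ltW.
  apply: le_trans (sqr_ge0 B) _.
  by rewrite -[X in (X <= _)%R]expRK ler_ln ?posrE ?expR_gt0// ltW.
have s0 : (0 < Num.sqrt (ln g))%R by exact: lt_le_trans Bs.
apply: (@le_lt_trans _ _ (`|C| / Num.sqrt (ln g))%R).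
  by rewrite ler_wpM2r ?invr_ge0 ?(ltW s0)// ler_norm.
rewrite ltr_pdivrMr//; apply: (@lt_le_trans _ _ (e * B)%R).
  by rewrite /B mulrDr mulrCA mulfV ?gt_eqF// !mulr1 ltrDl.
by rewrite ler_wpM2l// ltW.
Unshelve. all: by end_near. Qed.

(** The windows must be long compared with the delay, which is of order
    [t ^+ 2], and short enough for [ln m] to be negligible before [t ^+ 2];
    length [t ^+ 3] does both. *)
Lemma window_length g t : (0 < g)%R -> ln g = (t ^+ 2)%R -> (6 <= t)%R ->
  exists m : nat, [/\ (0 < m)%N, (2 * m%:R <= g)%R,
    (t ^+ 2 - 6 * t <= ln (g / (2 * m%:R)))%R &
    (ln (g / (2 * m%:R)) / m%:R <= t^-1)%R].
Proof.
move=> g0 gt t6; have t0 : (0 < t)%R by lra.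
pose m := (Num.truncn (t ^+ 3)).+1.
have t30 : (0 <= t ^+ 3)%R by rewrite exprn_ge0// ltW.
have mt : (t ^+ 3 < m%:R)%R by exact: truncnS_gt.
have tm : (m%:R <= t ^+ 3 + 1)%R.
  by rewrite /m -natr1 lerD2r truncn_le.
have t3 : (1 <= t ^+ 3)%R by apply: exprn_ege1; lra.
have m0 : (0 < m%:R :> R)%R by rewrite ltr0n.
have m2 : (0 < 2 * m%:R :> R)%R by rewrite mulr_gt0.
have mle : (2 * m%:R <= (2 * t) ^+ 3)%R.
  by rewrite exprMn (_ : 2 ^+ 3 = 8%:R)%R; [lra|rewrite -natrX].
have lnm : (ln (2 * m%:R) <= 6 * t)%R.
  apply: (@le_trans _ _ (ln ((2 * t) ^+ 3))).
    by rewrite ler_ln ?posrE// exprn_gt0// mulr_gt0.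
  rewrite lnXn ?mulr_gt0// -(mulr_natl (ln (2 * t)%R) 3).
  have : (ln (2 * t) <= 2 * t)%R.
    have := @expR_ge1Dx R (ln (2 * t)); rewrite lnK ?posrE ?mulr_gt0//; lra.
  lra.
have t2 : (6 * t <= t ^+ 2)%R by rewrite expr2 ler_wpM2r// ltW.
exists m; split => //.
- by rewrite -ler_ln ?posrE// gt (le_trans lnm).
- by rewrite ln_div ?posrE// gt; lra.
rewrite ln_div ?posrE// gt ler_pdivrMr//.
have : (0 <= ln (2 * m%:R : R))%R.
  apply: ln_ge0; have : (1 <= m%:R :> R)%R by rewrite ler1n.
  lra.
have : (t ^+ 2 <= t^-1 * m%:R)%R.
  rewrite -(ler_pM2l t0) [X in (_ <= X)%R]mulrA mulfV ?gt_eqF// mul1r -exprS.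
  exact: ltW.
lra.
Qed.

(** Both bounds are [t ^+ 2 / I * (1 + O(t^-1))]; the condition
    [2 * (7 + I^-1) <= t] keeps the lower one above half of its leading term. *)
Lemma squeeze_ratio I C t (rho om : R) : (0 < I)%R -> (0 <= C)%R -> (1 <= t)%R ->
  (2 * (7 + I^-1) <= t)%R ->
  ((t ^+ 2 - 6 * t - 1) / (I + t^-1) <= om)%R -> (om <= rho)%R ->
  (rho <= (t ^+ 2 + C) / I)%R ->
  [/\ (0 < om)%R, (`|rho / om - 1| <= 2 * (7 + I^-1 + C) / t)%R &
      (`|rho / (t ^+ 2 / I) - 1| <= (7 + I^-1 + C) / t)%R].
Proof.
move=> I0 C0 t1 tI lb omrho ub.
have t0 : (0 < t)%R by lra.
set z := (t^-1)%R; have z0 : (0 < z)%R by rewrite invr_gt0.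
have zt : (z * t = 1)%R by rewrite mulVf// gt_eqF.
set i := (I^-1)%R; have i0 : (0 < i)%R by rewrite invr_gt0.
have iI : (i * I = 1)%R by rewrite mulVf// gt_eqF.
have z1 : (z <= 1)%R by rewrite -(ler_pM2r t0) zt mul1r.
pose X := (t ^+ 2 * i)%R.
have X0 : (0 < X)%R by rewrite mulr_gt0// exprn_gt0.
have tz : (t = z * t ^+ 2)%R by rewrite expr2 mulrA zt mul1r.
have one : (1 <= z * t ^+ 2)%R by rewrite -tz.
have Cz : ((7 + i) * z <= 2^-1)%R.
  rewrite -(ler_pM2r t0) -mulrA zt mulr1; move: tI; rewrite -/i; lra.
have lb' : (X * (1 - (7 + i) * z) <= om)%R.
  apply: le_trans lb; rewrite ler_pdivlMr ?addr_gt0//.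
  apply: (@le_trans _ _ (t ^+ 2 * (1 - 7 * z))%R); last first.
    have -> : (t ^+ 2 * (1 - 7 * z) = t ^+ 2 - 7 * (z * t ^+ 2))%R by ring.
    by rewrite -tz; lra.
  have -> : (X * (1 - (7 + i) * z) * (I + z) =
    t ^+ 2 * ((i * I) * (1 - (7 + i) * z) + i * z * (1 - (7 + i) * z)))%R.
    by rewrite /X; ring.
  rewrite ler_wpM2l ?sqr_ge0// iI.
  have : (0 <= i * z * ((7 + i) * z))%R by rewrite !mulr_ge0// ?addr_ge0// ltW.
  lra.
have ub' : (rho <= X * (1 + C * z))%R.
  apply: le_trans ub _; rewrite /X -/i mulrDl mulrDr mulr1 lerD2l.
  have -> : (t ^+ 2 * i * (C * z) = C * i * (z * t ^+ 2))%R by ring.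
  by rewrite ler_peMr// mulr_ge0// ltW.
have om0 : (0 < om)%R by apply: lt_le_trans lb'; rewrite mulr_gt0//; lra.
have zC : (0 <= C * z)%R by rewrite mulr_ge0// ltW.
have z7 : (0 <= (7 + i) * z)%R by rewrite mulr_ge0 ?addr_ge0// ltW.
split => //.
  rewrite ger0_norm; last by rewrite subr_ge0 ler_pdivlMr// mul1r.
  rewrite lerBlDr ler_pdivrMr//; apply: le_trans ub' _.
  apply: (@le_trans _ _ ((2 * (7 + i + C) * z + 1) *
      (X * (1 - (7 + i) * z)))%R); last first.
    by rewrite ler_wpM2l// addr_ge0// -mulrA mulr_ge0// mulrDl addr_ge0.
  rewrite [X in (_ <= X)%R]mulrCA ler_wpM2l ?(ltW X0)//.
  set a := ((7 + i) * z)%R in Cz z7 *; set b := (C * z)%R in zC *.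
  have -> : (2 * (7 + i + C) * z = 2 * (a + b))%R by rewrite /a /b; ring.
  have : (a * (a + b) <= 2^-1 * (a + b))%R by rewrite ler_wpM2r// addr_ge0.
  lra.
have EX : (t ^+ 2 / I = X)%R by [].
rewrite EX ler_norml; apply/andP; split.
  rewrite lerBrDr ler_pdivlMr//; apply: le_trans (le_trans lb' omrho).
  rewrite mulrC ler_wpM2l ?(ltW X0)//.
  by rewrite mulrDl -/z; lra.
rewrite lerBlDr ler_pdivrMr//; apply: le_trans ub' _.
rewrite mulrC ler_wpM2r ?(ltW X0)//.
by rewrite mulrDl -/z; lra.
Qed.

End asymptotics.

(** * Asymptotic optimality *)

Theorem theorem5p1 (R : realType) (d : nat)
    (* sample space, metric, and order of the Wasserstein distance *)
    (D : set (d.-tuple R)) (c : d.-tuple R -> d.-tuple R -> R) (s : R)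
    (* pre-change distribution and its density *)
    (Q : probability (d.-tuple R) R) (q : d.-tuple R -> R)
    (* training samples and radii *)
    (M : nat) (n : 'I_M -> nat) (omega : forall m, 'I_(n m).+1 -> d.-tuple R)
    (r : 'I_M -> R)
    (* least favorable distributions and dual maximizers *)
    (Pstar : 'I_M -> probability (d.-tuple R) R)
    (lam : 'I_M -> R) (u : forall m, 'I_(n m).+1 -> R)
    (* change-point model *)
    (dO : measure_display) (Omega : measurableType dO)
    (X : nat -> {mfun Omega >-> d.-tuple R}) (Pr_inf : probability Omega R)
    (Pr_chg : probability (d.-tuple R) R -> nat -> probability Omega R) :
  let mu := lebesgue_tuple d in
  let ball m := wasserstein_ball D c s (empirical (omega m)) (r m) in
  let Pset := \bigcup_(m in [set: 'I_M]) ball m in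
  let ell m := llr mu D c s q (omega m) (lam m) (u m) in
  let Istar := \big[mine/+oo]_(m < M) KL (Pstar m) Q in
  let tau gamma := tau_DR X ell (ln (M%:R * gamma)) in
  let risk t := ereal_sup [set WADD X (Pr_chg P) t | P in Pset] in
  let opt gamma := ereal_inf [set risk t | t in test_class X Pr_inf gamma] in
  measurable D ->
  is_metric_on D c ->
  measurable_fun (D `*` D) (fun z => c z.1 z.2) ->
  (1 <= s)%R ->
  (1 <= M)%N ->
  (forall m j, D (omega m j)) ->
  (forall m, (0 <= r m)%R) ->
  has_pdf mu D Q q ->
  ~ Pset Q ->
  (forall m, KL_minimizer Q (ball m) (Pstar m)) ->
  (forall m, dual_maximizer mu D c s (r m) q (omega m) (lam m) (u m)) ->
  (forall m, has_pdf mu D (Pstar m) (fun x => q x * expR (ell m x))%R) ->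
  change_point_model D Q X Pr_inf Pr_chg ->
  (forall gamma, (0 < gamma)%R -> test_class X Pr_inf gamma (tau gamma)) /\
  exists o1 o2 : R -> R,
    [/\ o1 x @[x --> +oo%R] --> (0%R : R), o2 x @[x --> +oo%R] --> (0%R : R) &
        \forall gamma \near +oo%R,
          risk (tau gamma) = opt gamma * (1 + o1 gamma)%:E /\
          opt gamma * (1 + o1 gamma)%:E =
            (ln gamma)%:E / Istar * (1 + o2 gamma)%:E].
Proof.
move=> mu ball Pset ell Istar tau risk opt mD metric_c mc s1 M1 Domega r0 Qq nQ
  KLmin dual Pq [XD XQ XP].
pose l m := ell m \_ D.
have tauE gamma : tau gamma = tau_DR X l (ln (M%:R * gamma)).
  by apply: (eq_tau_DR _ XD) => m x Dx; rewrite /l patchE mem_set.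
have lfd m : exists KI : R * R, [/\ (0 <= KI.1)%R, (forall x, l m x <= KI.1)%R,
    (0 < KI.2)%R & KL (Pstar m) Q = KI.2%:E] /\
    [/\ \int[Q]_x (expR (l m x))%:E = 1,
        (forall A, measurable A -> Q A = \int[Pstar m]_(x in A) (expR (- l m x))%:E),
        (KI.1 - KI.2)%:E <= \int[Pstar m]_x (KI.1 - l m x)%:E &
        forall P, ball m P -> \int[P]_x (KI.1 - l m x)%:E <= (KI.1 - KI.2)%:E].
  have [] := @least_favorable_distribution _ _ _ mu D c s (r m) Q q (n m)
    (omega m) (Pstar m) (lam m) (u m) (@measurable_set1_tuple R d) mD mc
    s1 (Domega m) (r0 m) Qq (dual m) (Pq m).
  - by have [] := KLmin m.
  - by move=> bQ; apply: nQ; exists m.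
  by move=> K [I [? ?]]; exists (K, I).
have [KI {}lfd] := choice lfd.
have ml m : measurable_fun setT (l m).
  exact: (measurable_llr_patch mu s q (lam m) (u m) mD mc (Domega m)).
have [m0 [IstarE Imin]] := bigmine_attained (fun m => KL (Pstar m) Q) M1.
rewrite -/Istar in IstarE Imin.
pose K := (\sum_m (KI m).1)%R; pose I := (KI m0).2.
have IE : Istar = I%:E by rewrite IstarE; have [[_ _ _ ->] _] := lfd m0.
have I0 : (0 < I)%R by have [[]] := lfd m0.
have Ile m : (I <= (KI m).2)%R.
  by rewrite -lee_fin -IE; have [[_ _ _ <-] _] := lfd m.
have Kge0 m : (0 <= (KI m).1)%R by have [[]] := lfd m.
have Kle m : ((KI m).1 <= K)%R by rewrite /K (bigD1 m)//= lerDl sumr_ge0.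
have K0 : (0 <= K)%R by exact: sumr_ge0.
have M0 : (0 < M%:R :> R)%R by rewrite ltr0n.
have lnM0 : (0 <= ln (M%:R : R))%R by apply: ln_ge0; rewrite ler1n.
have alarm gamma : (0 < gamma)%R -> test_class X Pr_inf gamma (tau gamma).
  move=> g0; rewrite tauE.
  by apply: (tau_DR_test_class ml XQ) => // m; have [_ []] := lfd m.
split=> //.
have ball1 m P : ball m P -> P D = 1 by move=> [[]].
have PsetP m : Pset (Pstar m) by exists m => //; have [] := KLmin m.
have upper gamma : (1 <= gamma)%R ->
    risk (tau gamma) <= ((ln gamma + (ln M%:R + K)) / I)%:E.
  move=> g1; have g0 : (0 < gamma)%R by lra.
  apply: ge_ereal_sup => _ [P [m _ bP] <-]; rewrite tauE.
  have [[_ lK Im KLE] [_ _ _ PI]] := lfd m.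
  apply: (le_trans (@WADD_tau_DR_le _ _ _ _ _ X M l (ln (M%:R * gamma)) ml
    (Pr_chg P) Q P m (KI m).1 (KI m).2 _ lK (PI P bP) Im (Kge0 m) _)).
  - by move=> nu nu1; apply: XP => //; exact: ball1 bP.
  - by apply: ln_ge0; apply: mulr_ege1 => //; rewrite ler1n.
  rewrite lee_fin lnM ?posrE//; apply: ler_pM.
  - by rewrite !addr_ge0// ln_ge0.
  - by rewrite invr_ge0 ltW.
  - by have := Kle m; lra.
  - by rewrite lef_pV2 ?posrE.
(* The information bound for windows of length about [t ^+ 3]. *)
pose LB t := ((t ^+ 2 - 6 * t - 1) / (I + t^-1))%R.
have lower gamma t : (7 <= t)%R -> (0 < gamma)%R -> ln gamma = (t ^+ 2)%R ->
    (LB t)%:E <= opt gamma.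
  move=> t7 g0 gt; have t0 : (0 < t)%R by lra.
  have [|m [mpos mg y1 y2]] := window_length g0 gt; first by lra.
  have [[_ lK _ _] [_ QP PI _]] := lfd m0.
  have It0 : (0 < I + t^-1)%R by rewrite addr_gt0// invr_gt0.
  apply: le_ereal_inf_tmp => _ [t' [t'P gt'] <-].
  apply: (@le_trans _ _ (WADD X (Pr_chg (Pstar m0)) t')); last first.
    by apply: ereal_sup_ubound; exists (Pstar m0).
  rewrite leNgt; apply/negP => WL.
  have LB0 : (0 < LB t)%R by rewrite /LB divr_gt0// expr2; nra.
  have [D0 [D00 WD DL]] : exists D0 : R, [/\ (0 <= D0)%R,
      WADD X (Pr_chg (Pstar m0)) t' <= D0%:E & (D0 < LB t)%R].
    case: (WADD _ _ _) WL => [w|//|_].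
    - rewrite lte_fin => wL; exists (Num.max w 0)%R.
      by rewrite lee_fin !le_max !lexx orbT gt_max wL.
    - by exists 0%R; rewrite leNye.
  have := WADD_information_bound t'P XQ _ (ml m0) lK PI (Kge0 m0) (ltW I0) QP
    mpos mg gt' D00 WD.
  have XPs nu : (1 <= nu)%N -> independent_with_laws (Pr_chg (Pstar m0) nu) X
      (fun k => if (k < nu)%N then Q else Pstar m0).
    move=> nu1; apply: XP => //.
    by apply: (ball1 m0); have [] := KLmin m0.
  move=> /(_ XPs) info.
  suff : (LB t <= D0)%R by rewrite leNgt DL.
  rewrite /LB ler_pdivrMr//; apply: le_trans (le_trans info _); first lra.
  by rewrite ler_wpM2l// lerD2l.
pose rho g := fine (risk (tau g)); pose om g := fine (opt g).
pose o1 g := (rho g / om g - 1)%R; pose o2 g := (rho g / (ln g / I) - 1)%R.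
pose C := (ln M%:R + K)%R; have C0 : (0 <= C)%R by exact: addr_ge0.
(* From 7 on the lower bound is positive; the other term makes it at least half
   of its leading term. *)
pose t0 := (Num.max 7 (2 * (7 + I^-1)))%R.
have main : \forall g \near +oo%R, [/\ risk (tau g) = (rho g)%:E,
    opt g = (om g)%:E, (0 < om g)%R /\ (0 < ln g)%R,
    (`|o1 g| <= 2 * (7 + I^-1 + C) / Num.sqrt (ln g))%R &
    (`|o2 g| <= (7 + I^-1 + C) / Num.sqrt (ln g))%R].
  near=> g.
  have gB : (expR (t0 ^+ 2) < g)%R by near: g; exact: nbhs_pinfty_gt.
  have g0 : (0 < g)%R by apply: lt_trans gB; exact: expR_gt0.
  have t07 : (7 <= t0)%R by rewrite /t0 le_max lexx.
  have lng : (t0 ^+ 2 < ln g)%R.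
    by rewrite -[X in (X < _)%R]expRK ltr_ln ?posrE ?expR_gt0.
  have lng0 : (0 < ln g)%R by apply: le_lt_trans lng; exact: sqr_ge0.
  set t := Num.sqrt (ln g).
  have gt : ln g = (t ^+ 2)%R by rewrite /t sqr_sqrtr// ltW.
  have tt0 : (t0 <= t)%R.
    rewrite -[X in (X <= _)%R](@ger0_norm _ t0); last exact: le_trans (ler0n _ 7) t07.
    by rewrite -sqrtr_sqr ler_sqrt// ltW.
  have t7 : (7 <= t)%R by exact: le_trans tt0.
  have g1 : (1 <= g)%R.
    rewrite -ler_ln ?posrE// ln1; exact: ltW.
  have U := upper g g1; have Lo := lower g t t7 g0 gt.
  have OR : opt g <= risk (tau g).
    by apply: ereal_inf_lbound; exists (tau g) => //; exact: alarm.
  have LB0 : (0 < LB t)%R.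
    apply: divr_gt0; first by rewrite expr2; nra.
    by rewrite addr_gt0// invr_gt0; lra.
  have riskE : risk (tau g) = (rho g)%:E.
    rewrite /rho fineK// ge0_fin_numE; first exact: le_lt_trans U (ltry _).
    by apply: le_trans (le_trans Lo OR); rewrite lee_fin ltW.
  have optE : opt g = (om g)%:E.
    rewrite /om fineK// ge0_fin_numE.
      by apply: le_lt_trans (le_trans OR U) (ltry _).
    by apply: le_trans Lo; rewrite lee_fin ltW.
  rewrite optE riskE lee_fin in OR; rewrite riskE lee_fin in U.
  rewrite optE lee_fin in Lo.
  rewrite gt in U.
  have tI : (2 * (7 + I^-1) <= t)%R.
    by apply: le_trans tt0; rewrite /t0 le_max lexx orbT.
  have [|? ? ?] := squeeze_ratio I0 C0 _ tI Lo OR U; first by lra.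
  by split => //; rewrite /o2 gt.
exists o1, o2; split.
- by apply: cvg0_of_le_sqrt_ln; apply: filterS main => g [_ _ _ o1C _]; exact: o1C.
- by apply: cvg0_of_le_sqrt_ln; apply: filterS main => g [_ _ _ _ o2C]; exact: o2C.
apply: filterS main => g [riskE optE [om0 lng0] _ _].
have E1 : opt g * (1 + o1 g)%:E = (rho g)%:E.
  by rewrite optE -EFinM /o1; congr EFin; field; exact: lt0r_neq0.
split; first by rewrite E1.
rewrite E1 IE inver gt_eqF// -!EFinM /o2; congr EFin; field.
by rewrite !lt0r_neq0.
Unshelve. all: by end_near. Qed.
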